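(* Let $\tau$ be the topology on $\mathbb{V}$ generated by the sets $T+\mathcal{U}_\varepsilon$ with $T\in\mathbb{V}$ and $\varepsilon>0$. Then: (A) $\tau$ is Hausdorff, translation invariant, and first-countable. (B) The family $\mathcal{F}=\{T+\mathcal{U}_\varepsilon: T\in\mathbb{V},\ \varepsilon>0\}$ is a basis for $\tau$, i.e. every open set in $\tau$ is a union of elements of $\mathcal{F}$. (C) If $A\in\mathcal{O}\in\tau$, then there exists $r>0$ such that $A+\mathcal{U}_r\subset\mathcal{O}$. In particular, $\tau$ is not the discrete topology on $\mathbb{V}$. (D) Let $A_0\in\Gamma\setminus\Gamma_+$ (such an $A_0$ exists). Then the subspace $\{tA_0: t\in\mathbb{R}\}$ with the topology induced by $\tau$ is discrete. (E) $\tau$ is not second-countable.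
   Context: Scalars are $\mathbb{R}$ or $\mathbb{C}$; $\ell_p=\ell_p(\mathbb{N})$ with standard basis $(\delta_k)$; for $x\in\ell_1\subset\ell_2$, $xx^*$ is the rank-one operator $v\mapsto\langle v,x\rangle x$. $\mathbb{V}$ is the real vector space of bounded self-adjoint operators $A:\ell_2\to\ell_2$ with $\|A\|_{1,1}:=\sum_{k,l=1}^\infty|\langle A\delta_k,\delta_l\rangle|<\infty$. $\Gamma:=\{A\in\mathbb{V}:\langle Ax,x\rangle\ge0\ \forall x\in\ell_2\}$. For $A\in\Gamma$, $\gamma_+(A):=\inf\{\sum_{k=1}^\infty\|x_k\|_1^2: (x_k)\subset\ell_1,\ A=\sum_{k=1}^\infty x_kx_k^*\text{ strongly}\}$ with $\inf\varnothing=\infty$, and $\Gamma_+:=\{A\in\Gamma:\gamma_+(A)<\infty\}$. For $\varepsilon>0$, $\mathcal{U}_\varepsilon:=\{A\in\Gamma_+:\gamma_+(A)<\varepsilon\}$. *)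

(* Defs.v *)
From HB Require Import structures.
From mathcomp Require Import all_boot all_order all_algebra.
From mathcomp Require Import complex lra.
From mathcomp Require Import all_classical all_reals all_analysis.

Set Implicit Arguments.
Unset Strict Implicit.
Unset Printing Implicit Defensive.

Import Order.TTheory GRing.Theory Num.Theory.
Import numFieldNormedType.Exports.

Local Open Scope classical_set_scope.
Local Open Scope ring_scope.

Variant scalar_kind := RealScalars | ComplexScalars.

Definition scalar (R : realType) (F : scalar_kind) : numFieldType :=
  match F with RealScalars => R | ComplexScalars => R[i] end.

Definition sconj (R : realType) (F : scalar_kind) :
    scalar R F -> scalar R F :=
  match F with RealScalars => id | ComplexScalars => @conjc R end.

(* The norm of the numFieldType [scalar R F] takes its values in that field;
   [sabs] is the same modulus with values in R. *)
Definition sabs (R : realType) (F : scalar_kind) : scalar R F -> R :=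
  match F with
  | RealScalars => fun z : R => `|z|
  | ComplexScalars => @ComplexField.Normc.normc R
  end.

Definition of_real (R : realType) (F : scalar_kind) : R -> scalar R F :=
  match F with RealScalars => id | ComplexScalars => fun t : R => t%:C%C end.

Section Scalars.
Context {R : realType} {F : scalar_kind}.
Local Notation K := (scalar R F).
Implicit Types (z w : K) (t : R).

Lemma normr_sabs z : `|z| = of_real F (sabs z).
Proof. by case: F z => //= -[a b]; rewrite normc_def. Qed.

Lemma of_realD : {morph @of_real R F : a b / a + b}.
Proof. by case: F => //= a b; rewrite rmorphD. Qed.

Lemma of_realM : {morph @of_real R F : a b / a * b}.
Proof. by case: F => //= a b; rewrite rmorphM. Qed.

Lemma of_real1 : of_real F (1 : R) = 1.
Proof. by case: F. Qed.

Lemma of_realN1 : of_real F (- 1 : R) = - 1.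
Proof. by case: F => //=; rewrite rmorphN1. Qed.

Lemma of_real0 : of_real F (0 : R) = 0.
Proof. by case: F. Qed.

Lemma ler_of_real a b : (of_real F (a : R) <= of_real F b) = (a <= b).
Proof. by case: F => //=; rewrite lecR. Qed.

Lemma ltr_of_real a b : (of_real F (a : R) < of_real F b) = (a < b).
Proof. by case: F => //=; rewrite ltcR. Qed.

Lemma of_real_inj : injective (@of_real R F).
Proof. by case: F => //= a b []. Qed.

Lemma sabs_ge0 z : 0 <= sabs z.
Proof. by rewrite -ler_of_real -normr_sabs of_real0. Qed.

Lemma sabs0 : sabs (0 : K) = 0.
Proof. by apply: of_real_inj; rewrite -normr_sabs normr0 of_real0. Qed.

Lemma sabs1 : sabs (1 : K) = 1.
Proof. by apply: of_real_inj; rewrite -normr_sabs normr1 of_real1. Qed.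

Lemma sabsM z w : sabs (z * w) = sabs z * sabs w.
Proof. by apply: of_real_inj; rewrite of_realM -!normr_sabs normrM. Qed.

Lemma sabsN z : sabs (- z) = sabs z.
Proof. by apply: of_real_inj; rewrite -!normr_sabs normrN. Qed.

Lemma ler_sabsD z w : sabs (z + w) <= sabs z + sabs w.
Proof. by rewrite -ler_of_real of_realD -!normr_sabs ler_normD. Qed.

Lemma sconjD : {morph @sconj R F : z w / z + w}.
Proof. by case: F => //= z w; rewrite rmorphD. Qed.

Lemma sconj0 : sconj (0 : K) = 0.
Proof. by case: F => //=; rewrite oppr0. Qed.

Lemma sconjM : {morph @sconj R F : z w / z * w}.
Proof. by case: F => //= z w; rewrite rmorphM. Qed.

Lemma sconj_real t : sconj (of_real F t) = of_real F t.
Proof. by case: F => //; exact: conjc_real. Qed.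

Lemma sabs_conj z : sabs (sconj z) = sabs z.
Proof.
by case: F z => // -[a b] /=; rewrite sqrrN.
Qed.

End Scalars.

Section Series.
Context {R : realType}.

Lemma cvg_nneseries_fin (u : nat -> R) : (forall k, 0 <= u k) ->
  (\sum_(0 <= k <oo) (u k)%:E < +oo)%E -> cvgn (series u).
Proof.
move=> u0 uoo; apply: nondecreasing_is_cvgn.
  by apply/nondecreasing_seqP => n; rewrite /series /= big_nat_recr //= lerDl.
exists (fine (\sum_(0 <= k <oo) (u k)%:E)%E) => _ [n _ <-].
rewrite -lee_fin fineK; last first.
  by rewrite ge0_fin_numE // nneseries_ge0 // => k _ _; rewrite lee_fin.
rewrite /series /= -sumEFin; apply: nneseries_lim_ge => k _ _.
by rewrite lee_fin.
Qed.

Lemma cvg_series_scalar F (u : nat -> scalar R F) :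
  (\sum_(0 <= k <oo) (sabs (u k))%:E < +oo)%E -> cvgn (series u).
Proof.
case: F u => u /= uoo.
  by apply: normed_cvg; exact: cvg_nneseries_fin uoo.
have part (v : nat -> R) : (forall k, `|v k| <= ComplexField.Normc.normc (u k)) ->
    cvgn (series v).
  move=> vu; apply: normed_cvg; apply: cvg_nneseries_fin => [k|] /=; first exact: normr_ge0.
  by apply: le_lt_trans uoo; apply: lee_nneseries => k *; rewrite lee_fin ?normr_ge0 ?vu.
have /part/cvg_ex[a cva] : forall k, `|complex.Re (u k)| <= ComplexField.Normc.normc (u k).
  move=> k; case: (u k) => x y /=.
  by rewrite -sqrtr_sqr ler_sqrt ?lerDl ?addr_ge0 ?sqr_ge0.
have /part/cvg_ex[b cvb] : forall k, `|complex.Im (u k)| <= ComplexField.Normc.normc (u k).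
  move=> k; case: (u k) => x y /=.
  by rewrite -sqrtr_sqr ler_sqrt ?lerDr ?addr_ge0 ?sqr_ge0.
apply: (cvgP (Complex (a : R) b : scalar R ComplexScalars)).
apply/(@cvgrPdist_lt _ (scalar R ComplexScalars)) => -[e e'].
rewrite ltcE /= => /andP[/eqP-> e0].
have e20 : 0 < e / 2 by rewrite divr_gt0.
move/cvgrPdist_lt/(_ _ e20) : cva => cva; move/cvgrPdist_lt/(_ _ e20) : cvb => cvb.
near=> n.
have an : `|a - series (@complex.Re R \o u) n| < e / 2 by near: n.
have bn : `|b - series (@complex.Im R \o u) n| < e / 2 by near: n.
have -> : series u n = Complex (series (@complex.Re R \o u) n) (series (@complex.Im R \o u) n).
  rewrite /series /=; elim: (n) => [|m ih]; first by rewrite !big_nil.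
  by rewrite !big_nat_recr //= ih; case: (u m).
rewrite normc_def ltcR /=.
set x := a - _ in an *; set y := b - _ in bn *.
rewrite -(ger0_norm (ltW e0)) -sqrtr_sqr ltr_sqrt ?exprn_gt0 //.
rewrite -(real_normK (num_real x)) -(real_normK (num_real y)).
have xye : `|x| + `|y| < e by rewrite (splitr e) ltrD.
apply: (@le_lt_trans _ _ ((`|x| + `|y|) ^+ 2)).
  by rewrite sqrrD -addrA lerD2l lerDr mulrn_wge0 // mulr_ge0.
by rewrite ltrXn2r // ?nnegrE ?addr_ge0 // ltW.
Unshelve. all: by end_near. Qed.

End Series.

Section SequenceSpaces.
Context (R : realType) (F : scalar_kind).
Local Notation K := (scalar R F).

Definition sqsum (x : nat -> K) : \bar R :=
  (\sum_(0 <= k <oo) (sabs (x k) ^+ 2)%:E)%E.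

Definition l2_pred : {pred nat -> K} := [pred x | `[< (sqsum x < +oo)%E >]].

Lemma l2_predP x : reflect (sqsum x < +oo)%E (x \in l2_pred).
Proof. exact: asboolP. Qed.

Lemma sqsum_ge0 x : (0 <= sqsum x)%E.
Proof. by apply: nneseries_ge0 => k _ _; rewrite lee_fin exprn_ge0 ?sabs_ge0. Qed.

Lemma sqsumZ a x : sqsum (a *: x) = ((sabs a ^+ 2)%:E * sqsum x)%E.
Proof.
rewrite -nneseriesZl => [|k _]; last by rewrite lee_fin exprn_ge0 ?sabs_ge0.
by apply: eq_eseriesr => k _; rewrite -EFinM -exprMn -sabsM.
Qed.

Lemma sqsumD x y : (sqsum (x + y)%R <= 2%:E * (sqsum x + sqsum y))%E.
Proof.
rewrite -nneseriesD => [|k _ _|k _ _]; do ?by rewrite lee_fin exprn_ge0 ?sabs_ge0.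
rewrite -nneseriesZl => [|k _]; last first.
  by rewrite -EFinD lee_fin addr_ge0 ?exprn_ge0 ?sabs_ge0.
apply: lee_nneseries => [k _ _|k _]; first by rewrite lee_fin exprn_ge0 ?sabs_ge0.
rewrite -EFinD -EFinM lee_fin.
set a := sabs (x k); set b := sabs (y k).
apply: (@le_trans _ _ ((a + b) ^+ 2)).
  by rewrite lerXn2r ?nnegrE ?addr_ge0 ?sabs_ge0 // ler_sabsD.
by have := sqr_ge0 (a - b); lra.
Qed.

Lemma l2_submod_closed : submod_closed l2_pred.
Proof.
split=> [|a x y].
  apply/l2_predP; rewrite /sqsum eseries0 ?ltry // => k _ _.
  by rewrite /= sabs0 expr0n.
move=> /l2_predP xoo /l2_predP yoo; apply/l2_predP.
apply: (le_lt_trans (sqsumD _ _)); rewrite sqsumZ.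
rewrite lte_mul_pinfty ?lee_fin // lte_add_pinfty //.
by rewrite lte_mul_pinfty ?lee_fin ?sqr_ge0.
Qed.

HB.instance Definition _ := GRing.isSubmodClosed.Build K (nat -> K) l2_pred
  l2_submod_closed.

Record l2 := L2 { l2_seq :> nat -> K; l2_seqP : l2_seq \in l2_pred }.

HB.instance Definition _ := [isSub for l2_seq].
HB.instance Definition _ := [Choice of l2 by <:].
HB.instance Definition _ := [SubChoice_isSubLmodule of l2 by <:].
End SequenceSpaces.

Section HilbertSpace.
Context {R : realType} {F : scalar_kind}.
Local Notation K := (scalar R F).
Local Notation H := (l2 R F).
Implicit Types (x y z : H) (a : K) (t : R).

(* Linear in the first argument, conjugate-linear in the second.  The series
   converges in the scalar field for all x and y: see [cvg_inner]. *)
Definition inner x y : K := limn (series (fun k => x k * sconj (y k))).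

Definition l2norm x : R := Num.sqrt (fine (sqsum x)).

Definition l1norm x : \bar R := (\sum_(0 <= k <oo) (sabs (x k))%:E)%E.

Lemma sqsum_delta k : (sqsum (fun j => (j == k)%:R : K) < +oo)%E.
Proof.
rewrite /sqsum (@nneseriesD1 _ _ k) => [|j _|//]; last first.
  by rewrite lee_fin exprn_ge0 ?sabs_ge0.
rewrite eseries0 => [|j _ /andP[_ /negPf->]]; last by rewrite sabs0 expr0n.
by rewrite adde0 ltry.
Qed.

Definition delta k : H := L2 (introT (l2_predP _) (sqsum_delta k)).

Lemma sqsum_fin x : sqsum x \is a fin_num.
Proof. by rewrite ge0_fin_numE ?sqsum_ge0 //; apply/l2_predP/l2_seqP. Qed.

Lemma sqr_l2norm x : l2norm x ^+ 2 = fine (sqsum x).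
Proof. by rewrite sqr_sqrtr // fine_ge0 // sqsum_ge0. Qed.

Lemma l2norm_ge0 x : 0 <= l2norm x.
Proof. exact: sqrtr_ge0. Qed.

Lemma l2normZ a x : l2norm (a *: x) = sabs a * l2norm x.
Proof.
rewrite /l2norm [X in sqsum X](_ : _ = a *: (x : nat -> K)) // sqsumZ.
rewrite fineM ?sqsum_fin //= sqrtrM ?sqr_ge0 //.
by rewrite sqrtr_sqr ger0_norm ?sabs_ge0.
Qed.

Lemma ler_l2normD x y : l2norm (x + y) <= 2 * (l2norm x + l2norm y).
Proof.
have xy0 : 0 <= l2norm x + l2norm y by rewrite addr_ge0 ?l2norm_ge0.
rewrite -(@ler_pXn2r _ 2) ?nnegrE ?mulr_ge0 ?l2norm_ge0 //.
apply: (@le_trans _ _ (2 * (l2norm x ^+ 2 + l2norm y ^+ 2))); last first.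
  by have := l2norm_ge0 x; have := l2norm_ge0 y; nra.
rewrite !sqr_l2norm -fineD ?sqsum_fin //.
rewrite -[2]/(fine (2%:E : \bar R)) -fineM ?fin_numD ?sqsum_fin //.
rewrite fine_le ?fin_numM ?fin_numD ?sqsum_fin //; exact: sqsumD.
Qed.

Lemma cvg_inner x y : cvgn (series (fun k => x k * sconj (y k))).
Proof.
apply: cvg_series_scalar.
apply: (@le_lt_trans _ _ (sqsum x + sqsum y)%E); last first.
  by rewrite -ge0_fin_numE ?adde_ge0 ?sqsum_ge0 // fin_numD !sqsum_fin.
rewrite -nneseriesD => [|k _ _|k _ _]; do ?by rewrite lee_fin sqr_ge0.
apply: lee_nneseries => [k _ _|k _]; first by rewrite lee_fin sabs_ge0.
rewrite -EFinD lee_fin sabsM sabs_conj.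
by have := sqr_ge0 (sabs (x k)); have := sqr_ge0 (sabs (y k));
  have := sqr_ge0 (sabs (x k) - sabs (y k)); nra.
Qed.

Lemma innerDl x y z : inner (x + y) z = inner x z + inner y z.
Proof.
rewrite /inner -(lim_seriesD (@cvg_inner x z) (@cvg_inner y z)).
by congr (limn (series _)); apply/funext => k /=; rewrite mulrDl.
Qed.

Lemma innerDr x y z : inner x (y + z) = inner x y + inner x z.
Proof.
rewrite /inner -(lim_seriesD (@cvg_inner x y) (@cvg_inner x z)).
by congr (limn (series _)); apply/funext => k /=; rewrite sconjD mulrDr.
Qed.

Lemma innerZl a x y : inner (a *: x) y = a * inner x y.
Proof.
rewrite /inner -[RHS](lim_seriesZ a (@cvg_inner x y)).
by congr (limn (series _)); apply/funext => k /=; rewrite -mulrA.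
Qed.

Lemma innerZr a x y : inner x (a *: y) = sconj a * inner x y.
Proof.
rewrite /inner -[RHS](lim_seriesZ (sconj a) (@cvg_inner x y)).
by congr (limn (series _)); apply/funext => k /=; rewrite sconjM mulrCA.
Qed.

End HilbertSpace.

Section Operators.
Context (R : realType) (F : scalar_kind).
Local Notation K := (scalar R F).
Local Notation H := (l2 R F).
Implicit Types (A B : H -> H).

Definition bounded_op A := exists M : R, forall x, l2norm (A x) <= M * l2norm x.

Definition self_adjoint A := forall x y, inner (A x) y = inner x (A y).

Definition norm11 A : \bar R :=
  (\sum_(0 <= k <oo) \sum_(0 <= l <oo)
     (sabs (inner (A (delta k)) (delta l)))%:E)%E.

Definition opV_pred : {pred H -> H} :=
  [pred A | `[< [/\ linear A, bounded_op A, self_adjoint A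
                  & (norm11 A < +oo)%E] >]].

Lemma opV_predP A :
  reflect [/\ linear A, bounded_op A, self_adjoint A & (norm11 A < +oo)%E]
    (A \in opV_pred).
Proof. exact: asboolP. Qed.

Lemma opV_pred0 : 0 \in opV_pred.
Proof.
have in0 (y : H) : inner 0 y = 0.
  by have := innerZl 0 0 y; rewrite scale0r mul0r.
apply/opV_predP; split.
- by move=> a x y; rewrite /= scaler0 addr0.
- exists 0 => x; rewrite mul0r.
  by have := l2normZ 0 x; rewrite scale0r sabs0 mul0r => ->.
- move=> x y /=; rewrite in0.
  by have := innerZr 0 x 0; rewrite scale0r => ->; rewrite sconj0 mul0r.
- rewrite /norm11 eseries0 ?ltry // => k _ _; rewrite eseries0 // => l _ _.
  by rewrite /= in0 sabs0.
Qed.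

Lemma opV_pred_comb t A B : A \in opV_pred -> B \in opV_pred ->
  A + of_real F t *: B \in opV_pred.
Proof.
move=> /opV_predP[lA [M AM] sA nA] /opV_predP[lB [N BN] sB nB].
have combE x : (A + of_real F t *: B) x = A x + of_real F t *: B x by [].
apply/opV_predP; split.
- move=> a x y; rewrite !combE lA lB !scalerDr !scalerA addrACA.
  by rewrite [_ * a]mulrC.
- exists (2 * (M + sabs (of_real F t) * N)) => x /=.
  apply: (le_trans (ler_l2normD _ _)); rewrite -mulrA ler_pM2l //.
  rewrite mulrDl lerD // l2normZ -mulrA ler_wpM2l ?sabs_ge0 //; exact: BN.
- move=> x y; rewrite !combE.
  by rewrite innerDl innerDr innerZl innerZr sconj_real sA sB.
- pose c := sabs (of_real F t).
  apply: (@le_lt_trans _ _ (norm11 A + c%:E * norm11 B)%E); last first.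
    by rewrite lte_add_pinfty // lte_mul_pinfty // lee_fin sabs_ge0.
  have n0 C k : (0 <= \sum_(0 <= l <oo)
      (sabs (inner (C (delta k)) (delta l)))%:E :> \bar R)%E.
    by apply: nneseries_ge0 => l _ _; rewrite lee_fin sabs_ge0.
  rewrite -nneseriesZl //.
  rewrite -nneseriesD => [|k _ _|k _ _] //; last first.
    by rewrite mule_ge0 // lee_fin sabs_ge0.
  apply: lee_nneseries => [k _ _|k _] //.
  rewrite -nneseriesZl => [|l _]; last by rewrite lee_fin sabs_ge0.
  rewrite -nneseriesD => [|l _ _|l _ _]; last 2 first.
  + by rewrite lee_fin sabs_ge0.
  + by rewrite -EFinM lee_fin mulr_ge0 ?sabs_ge0.
  apply: lee_nneseries => [l _ _|l _]; first by rewrite lee_fin sabs_ge0.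
  rewrite -EFinM -EFinD lee_fin combE innerDl innerZl.
  by apply: (le_trans (ler_sabsD _ _)); rewrite sabsM.
Qed.

Lemma opV_zmod_closed : zmod_closed opV_pred.
Proof.
split=> [|A B VA VB]; first exact: opV_pred0.
by have := opV_pred_comb (- 1) VA VB; rewrite of_realN1 scaleN1r.
Qed.

HB.instance Definition _ := GRing.isZmodClosed.Build (H -> H) opV_pred
  opV_zmod_closed.

(* The real vector space V of bounded self-adjoint operators A on l2 with
   ||A||_{1,1} < oo: an R-lmodType, also when the scalars are complex. *)
Record opV := OpV { opV_fun :> H -> H; opV_funP : opV_fun \in opV_pred }.

HB.instance Definition _ := [isSub for opV_fun].
HB.instance Definition _ := [Choice of opV by <:].
HB.instance Definition _ := [SubChoice_isSubZmodule of opV by <:].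

Lemma opV_scale_subproof (t : R) (A : opV) :
  of_real F t *: (A : H -> H) \in opV_pred.
Proof.
by rewrite -[_ *: _]add0r opV_pred_comb ?opV_pred0 ?opV_funP.
Qed.

Definition opV_scale (t : R) (A : opV) : opV := OpV (opV_scale_subproof t A).

Lemma opV_scaleA (s t : R) (A : opV) :
  opV_scale s (opV_scale t A) = opV_scale (s * t) A.
Proof. by apply: val_inj; rewrite /= scalerA of_realM. Qed.

Lemma opV_scale1 : left_id 1 opV_scale.
Proof. by move=> A; apply: val_inj; rewrite /= of_real1 scale1r. Qed.

Lemma opV_scaleDr : right_distributive opV_scale +%R.
Proof. by move=> t A B; apply: val_inj; rewrite /= scalerDr. Qed.

Lemma opV_scaleDl (A : opV) : {morph opV_scale^~ A : s t / s + t}.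
Proof. by move=> s t; apply: val_inj; rewrite /= of_realD scalerDl. Qed.

HB.instance Definition _ := GRing.Zmodule_isLmodule.Build R opV
  opV_scaleA opV_scale1 opV_scaleDr opV_scaleDl.

End Operators.

Section Topology.
Context {R : realType} {F : scalar_kind}.
Local Notation K := (scalar R F).
Local Notation H := (l2 R F).
Local Notation V := (opV R F).

(* Over R[i], [0 <= z] says that z is real and nonnegative. *)
Definition Gamma : set V := [set A | forall x : H, 0 <= inner (A x) x].

Definition rank_one (x : H) : H -> H := fun v => inner v x *: x.

(* A = \sum_k B_k in the strong operator topology. *)
Definition strong_sum (B : nat -> H -> H) (A : H -> H) :=
  forall v, l2norm (\sum_(0 <= k < n) B k v - A v) @[n --> \oo] --> (0 : R).

(* [ereal_inf set0 = +oo]. *)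
Definition gamma_plus (A : V) : \bar R :=
  ereal_inf [set s | exists x : nat -> H,
    [/\ forall k, (l1norm (x k) < +oo)%E,
        strong_sum (fun k => rank_one (x k)) A
      & s = (\sum_(0 <= k <oo) l1norm (x k) ^+ 2)%E]].

Definition Gamma_plus : set V := [set A | Gamma A /\ (gamma_plus A < +oo)%E].

Definition U_plus (eps : R) : set V :=
  [set A | Gamma_plus A /\ (gamma_plus A < eps%:E)%E].

Definition translate (T : V) (S : set V) : set V := [set T + A | A in S].

Definition basic_sets : set (set V) :=
  [set S | exists T eps, 0 < eps /\ S = translate T (U_plus eps)].

End Topology.

HB.instance Definition _ R F := isPointed.Build (opV R F) 0.

(* The canonical topology of [opV R F] is the one generated by [basic_sets],
   which are indexed here by the pairs (T, eps) with 0 < eps. *)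
HB.instance Definition _ R F := isSubBaseTopological.Build (opV R F)
  [set p : opV R F * R | 0 < p.2] (fun p => translate p.1 (U_plus p.2)).

Definition first_countable (X : topologicalType) :=
  forall x : X, exists B : set (set X),
    [/\ countable B, B `<=` nbhs x
      & forall N, nbhs x N -> exists2 M, B M & M `<=` N].

(* Main.v *)
Require Import Defs.
From mathcomp Require Import all_boot all_order all_algebra.
From mathcomp Require Import all_classical all_reals all_analysis.
From mathcomp Require Import complex ring lra.

(* Interleaving two decompositions shows that gamma_plus is subadditive on
   Gamma_plus, so the sets A + U_r form a neighbourhood basis at A; this gives
   (A)-(C), the Hausdorff property because every matrix entry of A is bounded by
   gamma_plus A.  If A0 is in Gamma but not in Gamma_plus, then s A0 - t A0 is in
   Gamma_plus only for s = t: for s > t by scaling, and for s < t because a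
   positive operator with nonpositive diagonal and a decomposition vanishes.
   Hence the line through A0 is discrete, and as it is uncountable the topology
   is not second-countable.

   Such an A0 is a block-diagonal sum of multiples of the Gram matrices
   B = sum_(k < r) eps_k eps_k^T of the first r Rademacher functions on
   {0, ..., n - 1}, n = 2^r.  The entries of B sum in absolute value to at most
   n^2 sqrt r.  By Khintchine's inequality the symmetric matrix
   W = 9/8 sum_k eps_k eps_k^T - n I satisfies <W u, u> <= |u|_1^2 for real u, so
   gamma_plus B >= <W, B> / 2 >= n^2 r / 16 (the factor 2 accounts for complex
   vectors), and the ratio of the two norms is at least sqrt r / 16. *)

Set Implicit Arguments.
Unset Strict Implicit.
Unset Printing Implicit Defensive.

Import Order.TTheory GRing.Theory Num.Theory.
Import numFieldNormedType.Exports.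

Local Open Scope classical_set_scope.
Local Open Scope ring_scope.

(* ssralg also exports a notion named [scalar]. *)
Local Notation scalar := Defs.scalar.

(** * Rademacher functions and Khintchine's inequality *)

Section Rademacher.
Context {R : rcfType}.
Implicit Types (u b : nat -> R) (k r i j n : nat).

(** Cauchy-Schwarz against the constant vector: the squared deviations from the mean have
    nonnegative sum. *)
Lemma sqr_sum_le n (x : 'I_n -> R) : (\sum_i x i) ^+ 2 <= n%:R * \sum_i x i ^+ 2.
Proof.
case: n x => [|n] x; first by rewrite !big_ord0 expr0n mulr0.
set S := \sum_i x i; set Q := \sum_i _.
have n0 : 0 < n.+1%:R :> R by rewrite ltr0n.
have : 0 <= \sum_i (x i - S / n.+1%:R) ^+ 2 by apply: sumr_ge0 => i _; exact: sqr_ge0.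
rewrite (eq_bigr (fun i : 'I_n.+1 => x i ^+ 2 + - 2 * (S / n.+1%:R) * x i + (S / n.+1%:R) ^+ 2));
  last by move=> i _; ring.
rewrite !big_split /= sumr_const card_ord -/Q -mulr_sumr -/S -[X in _ + X]mulr_natl.
have -> : Q + - 2 * (S / n.+1%:R) * S + n.+1%:R * (S / n.+1%:R) ^+ 2
     = (n.+1%:R * Q - S ^+ 2) / n.+1%:R.
  by move: n0; move: (n.+1%:R) => m m0; field; rewrite gt_eqF.
by rewrite pmulr_lge0 ?invr_gt0 // subr_ge0.
Qed.

Lemma sum_double (V : nmodType) (G : nat -> V) r :
  \sum_(i < 2 ^ r.+1) G i = \sum_(i < 2 ^ r) G i + \sum_(i < 2 ^ r) G (2 ^ r + i)%N.
Proof. by rewrite expnS mul2n -addnn big_split_ord. Qed.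

(** The sign is read off binary digit k of i, so one formula on all naturals serves for every range
    [0, 2 ^ r) with k < r. *)
Definition rademacher k i : R := (-1) ^+ odd (i %/ 2 ^ k).

Lemma rademacher_sqr k i : rademacher k i ^+ 2 = 1.
Proof. by rewrite /rademacher sqrr_sign. Qed.

Lemma rademacher_shift k r i : (k < r)%N ->
  rademacher k (2 ^ r + i)%N = rademacher k i.
Proof.
move=> kr; rewrite /rademacher -{1}(subnK (ltnW kr)) expnD divnMDl ?expn_gt0 //.
by rewrite oddD oddX subn_eq0 leqNgt kr.
Qed.

Lemma rademacher_lo r i : (i < 2 ^ r)%N -> rademacher r i = 1.
Proof. by move=> ir; rewrite /rademacher divn_small. Qed.

Lemma rademacher_hi r i : (i < 2 ^ r)%N -> rademacher r (2 ^ r + i)%N = -1.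
Proof.
by move=> ir; rewrite /rademacher -{1}(mul1n (2 ^ r)%N) divnMDl ?expn_gt0 // divn_small.
Qed.

Definition rad_comb r b i : R := \sum_(k < r) b k * rademacher k i.

(** The halves of [0, 2 ^ r.+1) differ only in the sign of the last Rademacher function. This drives
    the induction for both moments. *)
Lemma sum_rad_combS r b (G : R -> R) :
  \sum_(i < 2 ^ r.+1) G (rad_comb r.+1 b i) =
  \sum_(i < 2 ^ r) (G (rad_comb r b i + b r) + G (rad_comb r b i - b r)).
Proof.
rewrite (sum_double (fun i => G (rad_comb r.+1 b i))) -big_split /=.
apply: eq_bigr => i _; congr (G _ + G _); rewrite /rad_comb big_ord_recr /=.
  by rewrite rademacher_lo // mulr1.
rewrite rademacher_hi // mulrN1; congr (_ - _).
by apply: eq_bigr => k _; rewrite rademacher_shift.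
Qed.

Lemma rad_comb_moment2 r b :
  \sum_(i < 2 ^ r) rad_comb r b i ^+ 2 = (2 ^ r)%:R * \sum_(k < r) b k ^+ 2.
Proof.
elim: r => [|r ih].
  by rewrite big_ord0 mulr0 big1 // => i _; rewrite /rad_comb big_ord0 expr0n.
rewrite (sum_rad_combS r b (fun y => y ^+ 2)) big_ord_recr /=.
rewrite (eq_bigr (fun i : 'I_(2 ^ r) => 2 * rad_comb r b i ^+ 2 + 2 * b r ^+ 2));
  last by move=> i _; ring.
rewrite big_split /= -mulr_sumr ih sumr_const card_ord -[_ *+ (2 ^ r)]mulr_natl expnS natrM.
by ring.
Qed.

(** In the inductive step (y + c)^4 + (y - c)^4 has cross term 12 c^2 y^2, which the cross term of 3
    (s + c^2)^2 matches exactly; only a nonnegative multiple of c^4 is left over. *)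
Lemma rad_comb_moment4 r b :
  \sum_(i < 2 ^ r) rad_comb r b i ^+ 4 <= 3 * (2 ^ r)%:R * (\sum_(k < r) b k ^+ 2) ^+ 2.
Proof.
elim: r => [|r ih].
  by rewrite big_ord0 expr0n mulr0 big1 // => i _; rewrite /rad_comb big_ord0 expr0n.
rewrite (sum_rad_combS r b (fun y => y ^+ 4)) big_ord_recr /=.
rewrite (eq_bigr (fun i : 'I_(2 ^ r) =>
  2 * rad_comb r b i ^+ 4 + 12 * b r ^+ 2 * rad_comb r b i ^+ 2 + 2 * b r ^+ 4));
  last by move=> i _; ring.
rewrite !big_split /= -!mulr_sumr rad_comb_moment2 sumr_const card_ord.
rewrite -[_ *+ (2 ^ r)]mulr_natl expnS natrM.
move: ih; set s := \sum_(k < r) _; set n := (2 ^ r)%:R; set S := \sum_i _ => ih.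
have n0 : 0 <= n by rewrite ler0n.
have : 0 <= n * (b r ^+ 2) ^+ 2 by rewrite mulr_ge0 ?sqr_ge0.
rewrite -subr_ge0 in ih; move=> h; rewrite -subr_ge0.
rewrite (_ : _ - _ = 2 * (3 * n * s ^+ 2 - S) + 4 * (n * (b r ^+ 2) ^+ 2)); last by ring.
by lra.
Qed.

(* Summing y^4 - 12 t^2 y^2 + 16 t^3 y = y (y - 2 t)^2 (y + 4 t) >= 0 over
   y = |rad_comb r b i| bounds the first moment by the second and fourth. *)
Lemma khintchine r b t : 0 <= t -> t ^+ 2 = \sum_(k < r) b k ^+ 2 ->
  9 / 16 * ((2 ^ r)%:R * t) <= \sum_(i < 2 ^ r) `|rad_comb r b i|.
Proof.
rewrite le_eqVlt => /predU1P[<- _|t0 tE].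
  by rewrite !mulr0 sumr_ge0.
rewrite -(ler_pM2l (_ : 0 < 16 * t ^+ 3)); last by rewrite mulr_gt0 ?exprn_gt0.
rewrite mulr_sumr.
have le1 : \sum_(i < 2 ^ r) (12 * t ^+ 2 * rad_comb r b i ^+ 2 - rad_comb r b i ^+ 4)
    <= \sum_(i < 2 ^ r) 16 * t ^+ 3 * `|rad_comb r b i|.
  apply: ler_sum => i _; set y := rad_comb r b i.
  have -> : y ^+ 4 = `|y| ^+ 4 by rewrite -[4%N]/(2 * 2)%N !exprM real_normK ?num_real.
  rewrite -(real_normK (num_real y)) -subr_ge0.
  rewrite (_ : _ - _ = `|y| * (`|y| - 2 * t) ^+ 2 * (`|y| + 4 * t)); last by ring.
  have := ltW t0; have := normr_ge0 y; move=> y0 t0w; apply: mulr_ge0; last by lra.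
  by rewrite mulr_ge0 ?sqr_ge0.
apply: le_trans le1; rewrite sumrB -mulr_sumr rad_comb_moment2 -tE.
have := rad_comb_moment4 r b; rewrite -tE => h4.
rewrite -subr_ge0 in h4; rewrite -subr_ge0.
set S := \sum_(i < _) _ in h4 *.
rewrite (_ : _ - _ = 3 * (2 ^ r)%:R * (t ^+ 2) ^+ 2 - S) //; by field.
Qed.

(** Split u into its orthogonal projection f onto the span of the Rademacher functions and the
    remainder g. Khintchine's inequality bounds |f|_1 from below, the triangle inequality bounds it
    above by |u|_1 + |g|_1, and Cauchy-Schwarz with Pythagoras controls |g|_1. *)
Lemma khintchine_dual r u :
  9 / 8 * (\sum_(k < r) (\sum_(i < 2 ^ r) rademacher k i * u i) ^+ 2)
    - (2 ^ r)%:R * (\sum_(i < 2 ^ r) u i ^+ 2) <= (\sum_(i < 2 ^ r) `|u i|) ^+ 2.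
Proof.
pose n : R := (2 ^ r)%:R; have n0 : 0 < n by rewrite ltr0n expn_gt0.
have nN0 : n != 0 by rewrite gt_eqF.
pose B k := \sum_(i < 2 ^ r) rademacher k i * u i; rewrite -/n.
pose f := rad_comb r (fun k => B k / n).
pose t := Num.sqrt (\sum_(k < r) (B k / n) ^+ 2).
have tE : t ^+ 2 = \sum_(k < r) (B k / n) ^+ 2.
  by rewrite sqr_sqrtr // sumr_ge0 // => k _; exact: sqr_ge0.
have Bt : \sum_(k < r) B k ^+ 2 = n ^+ 2 * t ^+ 2.
  by rewrite tE mulr_sumr; apply: eq_bigr => k _; field.
have uf : \sum_(i < 2 ^ r) u i * f i = n * t ^+ 2.
  under eq_bigr do rewrite /f /rad_comb mulr_sumr.
  rewrite exchange_big /= tE mulr_sumr; apply: eq_bigr => k _.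
  transitivity (B k / n * B k); last by field.
  by rewrite [X in _ = _ * X]/B mulr_sumr; apply: eq_bigr => i _; ring.
have ff : \sum_(i < 2 ^ r) f i ^+ 2 = n * t ^+ 2 by rewrite rad_comb_moment2 tE.
pose g i := u i - f i.
have gg : \sum_(i < 2 ^ r) g i ^+ 2 = \sum_(i < 2 ^ r) u i ^+ 2 - n * t ^+ 2.
  rewrite (eq_bigr (fun i : 'I_(2 ^ r) => u i ^+ 2 + (-2) * (u i * f i) + f i ^+ 2));
    last by move=> i _; rewrite /g; ring.
  by rewrite !big_split /= -mulr_sumr uf ff; ring.
have G2 := sqr_sum_le (fun i : 'I_(2 ^ r) => `|g i|).
have {}G2 : (\sum_(i < 2 ^ r) `|g i|) ^+ 2 <= n * (\sum_(i < 2 ^ r) u i ^+ 2 - n * t ^+ 2).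
  rewrite -gg; apply: (le_trans G2); rewrite ler_pM2l //.
  by apply: ler_sum => i _; rewrite real_normK ?num_real.
have F1 : 9 / 16 * (n * t) <= \sum_(i < 2 ^ r) `|f i| by apply: khintchine; rewrite ?sqrtr_ge0.
have F2 : \sum_(i < 2 ^ r) `|f i| <= \sum_(i < 2 ^ r) `|u i| + \sum_(i < 2 ^ r) `|g i|.
  rewrite -big_split /=; apply: ler_sum => i _; rewrite /g.
  by rewrite -[X in `|X| <= _](subKr (u i)); apply: (le_trans (ler_normB _ _)).
have {F1 F2} F := le_trans F1 F2.
rewrite -/n (_ : \sum_(k < r) _ = n ^+ 2 * t ^+ 2) //.
move: F G2; set L := \sum_(i < _) `|u i|; set G := \sum_(i < _) `|g i|; set U := \sum_(i < _) u i ^+ 2.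
have L0 : 0 <= L by apply: sumr_ge0.
have G0 : 0 <= G by apply: sumr_ge0.
have t0 : 0 <= t by rewrite sqrtr_ge0.
move=> F G2.
have X2 : (9 / 16 * (n * t)) ^+ 2 <= 2 * (L ^+ 2 + G ^+ 2).
  apply: (@le_trans _ _ ((L + G) ^+ 2)).
    have nt0 : 0 <= n * t by exact: mulr_ge0 (ltW n0) t0.
    by apply: lerXn2r; rewrite ?nnegrE //; lra.
  by have := sqr_ge0 (L - G); nra.
have nt2 : 0 <= n ^+ 2 * t ^+ 2 by rewrite mulr_ge0 ?sqr_ge0.
have {}X2 : 81 / 256 * (n ^+ 2 * t ^+ 2) <= 2 * (L ^+ 2 + G ^+ 2).
  by apply: le_trans X2; rewrite le_eqVlt; apply/orP; left; apply/eqP; field.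
have {}G2 : G ^+ 2 <= n * U - n ^+ 2 * t ^+ 2.
  by rewrite (_ : n * U - _ = n * (U - n * t ^+ 2)) //; ring.
(* The constant 9/8 comes from here: half of 81/256 exceeds 1/8, and [G2] contributes the remaining
   1. *)
lra.
Qed.

Definition rad_gram r i j : R := \sum_(k < r) rademacher k i * rademacher k j.

Lemma rad_gram_shift r i j : rad_gram r (2 ^ r + i)%N (2 ^ r + j)%N = rad_gram r i j.
Proof. by apply: eq_bigr => k _; rewrite !rademacher_shift. Qed.

Lemma rad_gram_form r u :
  \sum_(i < 2 ^ r) \sum_(j < 2 ^ r) rad_gram r i j * (u i * u j) =
  \sum_(k < r) (\sum_(i < 2 ^ r) rademacher k i * u i) ^+ 2.
Proof.
under eq_bigr => i _ do (under eq_bigr do rewrite mulr_suml; rewrite exchange_big).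
rewrite exchange_big /=; apply: eq_bigr => k _.
rewrite expr2 mulr_suml; apply: eq_bigr => i _; rewrite mulr_sumr.
by apply: eq_bigr => j _; ring.
Qed.

(** A row of the Gram matrix is a Rademacher combination with coefficients of modulus 1, so its
    squared l2-norm is 2 ^ r * r, and Cauchy-Schwarz bounds its l1-norm. Here q stands for the
    square root of r. *)
Lemma rad_gram_norm r q : r = (q ^ 2)%N ->
  \sum_(i < 2 ^ r) \sum_(j < 2 ^ r) `|rad_gram r i j| <= (4 ^ r)%:R * q%:R.
Proof.
move=> rE; have row i : \sum_(j < 2 ^ r) `|rad_gram r i j| <= (2 ^ r)%:R * q%:R.
  rewrite -(@ler_pXn2r _ 2) ?nnegrE ?sumr_ge0 ?mulr_ge0 ?ler0n //.
  apply: (le_trans (sqr_sum_le _)); rewrite exprMn [_ ^+ 2]expr2 -mulrA ler_wpM2l ?ler0n //.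
  have := rad_comb_moment2 r (fun k => rademacher k i).
  under [X in _ = _ * X]eq_bigr do rewrite rademacher_sqr.
  rewrite sumr_const card_ord -natrX -rE => h.
  by rewrite -h; apply: ler_sum => j _; rewrite real_normK ?num_real.
apply: (@le_trans _ _ (\sum_(i < 2 ^ r) (2 ^ r)%:R * q%:R)); first by apply: ler_sum.
by rewrite sumr_const card_ord -[_ *+ _]mulr_natl mulrA -natrM -expnMn.
Qed.

(* The dual certificate: <W, M> for W = 9/8 sum_k eps_k eps_k^T - n I. *)
Definition rad_pairing r (M : nat -> nat -> R) : R :=
  9 / 8 * (\sum_(k < r) \sum_(i < 2 ^ r) \sum_(j < 2 ^ r)
             rademacher k i * rademacher k j * M i j)
    - (2 ^ r)%:R * \sum_(i < 2 ^ r) M i i.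

Lemma rad_pairing_rank1 r u :
  rad_pairing r (fun i j => u i * u j) <= (\sum_(i < 2 ^ r) `|u i|) ^+ 2.
Proof.
apply: le_trans (khintchine_dual r u); rewrite /rad_pairing le_eqVlt.
apply/orP; left; apply/eqP; congr (_ * _ - _); apply: eq_bigr => k _.
rewrite expr2 mulr_suml; apply: eq_bigr => i _; rewrite mulr_sumr.
by apply: eq_bigr => j _; ring.
Qed.

Lemma rad_pairingD r M N :
  rad_pairing r (fun i j => M i j + N i j) = rad_pairing r M + rad_pairing r N.
Proof.
rewrite /rad_pairing big_split /=.
under eq_bigr => k _ do
  (under eq_bigr => i _ do (under eq_bigr do rewrite mulrDr; rewrite big_split); rewrite big_split).
by rewrite big_split /=; ring.
Qed.

(** The first term of the pairing is a sum of squared inner products of Rademacher functions;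
    keeping only k = l gives r * 4 ^ r. The trace term removes this quantity once, and 9/8 - 1 = 1/8
    remains. *)
Lemma rad_pairing_gram c r : 0 <= c ->
  c * (r%:R * (4 ^ r)%:R) / 8 <= rad_pairing r (fun i j => c * rad_gram r i j).
Proof.
move=> c0; rewrite /rad_pairing -mulr_sumr.
under [X in _ <= _ - _ * (_ * X)]eq_bigr do
  (rewrite /rad_gram; under eq_bigr do rewrite -expr2 rademacher_sqr;
   rewrite sumr_const card_ord).
rewrite sumr_const card_ord.
pose q k l : R := \sum_(i < 2 ^ r) rademacher l i * rademacher k i.
have -> : \sum_(k < r) \sum_(i < 2 ^ r) \sum_(j < 2 ^ r)
   rademacher k i * rademacher k j * (c * rad_gram r i j) =
   c * \sum_(k < r) \sum_(l < r) q k l ^+ 2.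
  rewrite mulr_sumr; apply: eq_bigr => k _.
  rewrite -(rad_gram_form r (rademacher k)) mulr_sumr.
  by apply: eq_bigr => i _; rewrite mulr_sumr; apply: eq_bigr => j _; ring.
have : r%:R * (4 ^ r)%:R <= \sum_(k < r) \sum_(l < r) q k l ^+ 2.
  rewrite mulr_natl -[r in _ *+ r]card_ord -sumr_const; apply: ler_sum => k _.
  rewrite (bigD1 k) //= -[X in X <= _]addr0 lerD ?sumr_ge0 // => [|l _]; last exact: sqr_ge0.
  rewrite /q; under eq_bigr do rewrite -expr2 rademacher_sqr.
  by rewrite sumr_const card_ord -natrX -expnM mulnC expnM.
set Q := \sum_k _ => hQ; have : 0 <= c * (Q - r%:R * (4 ^ r)%:R) by rewrite mulr_ge0 ?subr_ge0.
rewrite -[r%:R *+ _]mulr_natr (_ : (4 ^ r)%:R = (2 ^ r)%:R * (2 ^ r)%:R :> R); last first.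
  by rewrite -natrM -expnMn.
set n : R := (2 ^ r)%:R; set rr : R := r%:R; nra.
Qed.

End Rademacher.

(** * The matrix of A0 *)

(* Block r.+1 is [2 ^ r, 2 ^ r.+1) and block 0 is {0}. *)
Definition dyadic_block (i : nat) : nat := up_log 2 i.+1.

Lemma dyadic_block_gt i : (i < 2 ^ dyadic_block i)%N.
Proof. exact: up_logP. Qed.

Lemma dyadic_block_le i r : (i < 2 ^ r)%N -> (dyadic_block i <= r)%N.
Proof. exact: up_log_min. Qed.

Lemma dyadic_block_shift i r : (i < 2 ^ r)%N -> dyadic_block (2 ^ r + i) = r.+1.
Proof.
move=> ir; apply: up_log_eq => //; rewrite ltnS leq_addr /=.
by rewrite expnS mul2n -addnn -addnS leq_add2l.
Qed.

Definition block_diagonal (V : nmodType) (a : nat -> nat -> V) :=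
  forall i j, dyadic_block i != dyadic_block j -> a i j = 0.

Section BlockDiagonal.
Context {V : nmodType}.
Implicit Types a : nat -> nat -> V.

(** This trades the cutoff that depends on the row for a common one, so that double sums over a
    square can be exchanged. *)
Lemma block_diagonal_row a i r : block_diagonal a -> (i < 2 ^ r)%N ->
  \sum_(j < 2 ^ dyadic_block i) a i j = \sum_(j < 2 ^ r) a i j.
Proof.
move=> ba ir; have br := dyadic_block_le ir.
rewrite -!(big_mkord xpredT (a i)) [RHS](big_cat_nat _ (n := (2 ^ dyadic_block i)%N)) //=.
  rewrite [X in _ + X]big_nat_cond [X in _ + X]big1 ?addr0 // => j /andP[/andP[ij _] _].
  apply: ba; apply: contraTN ij => /eqP ->.
  by rewrite -ltnNge dyadic_block_gt.
by rewrite leq_exp2l.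
Qed.

(** The off-diagonal quadrants pair indices of distinct blocks. Sums over dyadic squares can thus be
    treated by induction, one block at a time. *)
Lemma block_diagonal_double a r : block_diagonal a ->
  \sum_(i < 2 ^ r.+1) \sum_(j < 2 ^ r.+1) a i j =
  \sum_(i < 2 ^ r) \sum_(j < 2 ^ r) a i j +
  \sum_(i < 2 ^ r) \sum_(j < 2 ^ r) a (2 ^ r + i)%N (2 ^ r + j)%N.
Proof.
move=> ba; rewrite (sum_double (fun i => \sum_(j < 2 ^ r.+1) a i j)).
congr (_ + _); apply: eq_bigr => i _; rewrite sum_double.
  rewrite [X in _ + X]big1 ?addr0 // => j _; apply: ba.
  by rewrite dyadic_block_shift // neq_ltn ltnS dyadic_block_le.
rewrite [X in X + _]big1 ?add0r // => j _; apply: ba.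
by rewrite dyadic_block_shift // neq_ltn ltnS orbC dyadic_block_le.
Qed.

End BlockDiagonal.

Section Witness.
Context {R : rcfType}.
Implicit Types (u : nat -> R) (k r i j : nat).

(* Only r = 16 ^ k contributes: the Gram matrix of r Rademacher functions has
   l1-norm at most 4 ^ r * 4 ^ k, while its pairing is at least 4 ^ r * 16 ^ k / 8. *)
Definition block_coef r : R :=
  (4 ^ r)%:R^-1 * \sum_(k < r) (r == 16 ^ k)%N%:R * (8 ^ k)%:R^-1.

Lemma block_coef_ge0 r : 0 <= block_coef r.
Proof.
by rewrite mulr_ge0 ?invr_ge0 ?ler0n // sumr_ge0 // => k _; rewrite mulr_ge0 ?invr_ge0 ?ler0n.
Qed.

Lemma block_coef_ge k : (4 ^ (16 ^ k) * 8 ^ k)%:R^-1 <= block_coef (16 ^ k).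
Proof.
rewrite /block_coef natrM invfM ler_wpM2l ?invr_ge0 ?ler0n //.
(* The exponent k is in the range of summation because k < 16 ^ k. *)
rewrite (bigD1 (Ordinal (ltn_expl k (isT : (1 < 16)%N)))) //= eqxx mul1r lerDl.
by rewrite sumr_ge0 // => j _; rewrite mulr_ge0 ?invr_ge0 ?ler0n.
Qed.

(** Block r.+1 has 2 ^ r indices, hence the predecessor; block 0 gets an empty Gram sum. Indices
    need no translation inside a block, since adding 2 ^ r does not change the Rademacher functions
    with k < r. *)
Definition witness i j : R :=
  if dyadic_block i == dyadic_block j
  then block_coef (dyadic_block i).-1 * rad_gram (dyadic_block i).-1 i j else 0.

Lemma witness_block : block_diagonal witness.
Proof. by move=> i j /negPf ij; rewrite /witness ij. Qed.

Lemma witnessC i j : witness i j = witness j i.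
Proof.
rewrite /witness eq_sym; case: eqP => // ->; congr (_ * _).
by apply: eq_bigr => k _; rewrite mulrC.
Qed.

Lemma witness_shift r i j : (i < 2 ^ r)%N -> (j < 2 ^ r)%N ->
  witness (2 ^ r + i)%N (2 ^ r + j)%N = block_coef r * rad_gram r i j.
Proof.
by move=> ir jr; rewrite /witness !dyadic_block_shift // eqxx /= rad_gram_shift.
Qed.

Lemma witness00 : witness 0 0 = 0.
Proof. by rewrite /witness eqxx /rad_gram big_ord0 mulr0. Qed.

(** For r = 16 ^ k the square root of r is 4 ^ k; against the weight 1 / 8 ^ k it leaves the
    summable 1 / 2 ^ k. *)
Lemma block_coef_norm r :
  block_coef r * (\sum_(i < 2 ^ r) \sum_(j < 2 ^ r) `|rad_gram r i j|)
    <= \sum_(k < r) (r == 16 ^ k)%N%:R * (2 ^ k)%:R^-1.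
Proof.
rewrite /block_coef -mulrA mulr_suml mulr_sumr; apply: ler_sum => k _.
case: eqP => [rE|_]; last by rewrite !mul0r mulr0.
rewrite !mul1r.
have h : \sum_(i < 2 ^ r) \sum_(j < 2 ^ r) `|rad_gram r i j| <= (4 ^ r)%:R * (4 ^ k)%:R :> R.
  by apply: rad_gram_norm; rewrite -expnM mulnC expnM -rE.
apply: (@le_trans _ _ ((4 ^ r)%:R^-1 * ((8 ^ k)%:R^-1 * ((4 ^ r)%:R * (4 ^ k)%:R)))).
  by rewrite !ler_wpM2l ?invr_ge0 ?ler0n.
rewrite (_ : (8 ^ k)%:R = (4 ^ k)%:R * (2 ^ k)%:R :> R); last by rewrite -natrM -expnMn.
rewrite le_eqVlt; apply/orP; left; apply/eqP; field.
by rewrite !pnatr_eq0 -!lt0n !expn_gt0.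
Qed.

Lemma sum_half_le2 N : \sum_(k < N) (2 ^ k)%:R^-1 <= 2 :> R.
Proof.
have -> : \sum_(k < N) (2 ^ k)%:R^-1 = 2 - 2 * (2 ^ N)%:R^-1 :> R.
  elim: N => [|N ih]; first by rewrite big_ord0 expn0 invr1 mulr1 subrr.
  rewrite big_ord_recr /= ih expnS natrM; field.
  by rewrite pnatr_eq0 -lt0n expn_gt0.
by rewrite gerBl mulr_ge0 ?invr_ge0 ?ler0n.
Qed.

(** Each k is used by at most one block, so after exchanging the sums the total is at most a
    geometric series. *)
Lemma witness_norm r : \sum_(i < 2 ^ r) \sum_(j < 2 ^ r) `|witness i j| <= 2.
Proof.
suff h : \sum_(i < 2 ^ r) \sum_(j < 2 ^ r) `|witness i j|
    <= \sum_(s < r) \sum_(k < s) (s == 16 ^ k :> nat)%N%:R * (2 ^ k)%:R^-1.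
  apply: (le_trans h); apply: le_trans (sum_half_le2 r).
  apply: (@le_trans _ _ (\sum_(s < r) \sum_(k < r) (s == 16 ^ k :> nat)%N%:R * (2 ^ k)%:R^-1)).
    apply: ler_sum => s _.
    rewrite -!(big_mkord xpredT (fun k => (s == 16 ^ k :> nat)%N%:R * (2 ^ k)%:R^-1)).
    rewrite [leRHS](big_cat_nat _ (n := s)) ?(ltnW (ltn_ord s)) //= lerDl.
    by rewrite sumr_ge0 // => k _; rewrite mulr_ge0 ?invr_ge0 ?ler0n.
  rewrite exchange_big /=; apply: ler_sum => k _.
  rewrite -mulr_suml -[leRHS]mul1r ler_wpM2r ?invr_ge0 ?ler0n //.
  have [kr|kr] := ltnP (16 ^ k) r.
    rewrite (bigD1 (Ordinal kr)) //= eqxx big1 ?addr0 // => s.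
    by rewrite -val_eqE /= => /negPf->.
  rewrite big1 // => s _; case: eqP => // sE.
  by move: (ltn_ord s); rewrite sE ltnNge kr.
elim: r => [|r ih].
  by rewrite !big_ord1 witness00 normr0 big_ord0.
rewrite (@block_diagonal_double _ (fun i j => `|witness i j|)) => [|i j ij]; last first.
  by rewrite witness_block // normr0.
rewrite big_ord_recr /= lerD //; apply: le_trans (block_coef_norm r).
rewrite mulr_sumr; apply: ler_sum => i _; rewrite mulr_sumr; apply: ler_sum => j _.
by rewrite witness_shift // normrM ger0_norm ?block_coef_ge0.
Qed.

Lemma witness_psd r u :
  0 <= \sum_(i < 2 ^ r) \sum_(j < 2 ^ r) witness i j * (u i * u j).
Proof.
elim: r => [|r ih]; first by rewrite !big_ord1 witness00 mul0r.
rewrite (@block_diagonal_double _ (fun i j => witness i j * (u i * u j))) => [|i j ij].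
  rewrite addr_ge0 //.
  rewrite (_ : \sum_(i < _) _ = block_coef r *
     \sum_(i < 2 ^ r) \sum_(j < 2 ^ r) rad_gram r i j * (u (2 ^ r + i)%N * u (2 ^ r + j)%N)).
    rewrite (rad_gram_form r (fun i => u (2 ^ r + i)%N)) mulr_ge0 ?block_coef_ge0 //.
    by rewrite sumr_ge0 // => k _; rewrite sqr_ge0.
  rewrite mulr_sumr; apply: eq_bigr => i _; rewrite mulr_sumr; apply: eq_bigr => j _.
  by rewrite witness_shift // -mulrA.
by rewrite witness_block // mul0r.
Qed.

(** The factor r = 16 ^ k against the weight 1 / 8 ^ k leaves 2 ^ k: the pairings are unbounded
    although [witness] is absolutely summable. *)
Lemma witness_pairing k : let r := (16 ^ k)%N in
  (2 ^ k)%:R / 8 <= rad_pairing r (fun i j => witness (2 ^ r + i)%N (2 ^ r + j)%N).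
Proof.
rewrite /=; set r := (16 ^ k)%N.
rewrite (_ : rad_pairing _ _ = rad_pairing r (fun i j => block_coef r * rad_gram r i j)).
  apply: le_trans (rad_pairing_gram r (block_coef_ge0 r)).
  rewrite ler_pM2r ?invr_gt0 //; apply: le_trans (ler_wpM2r _ (block_coef_ge k)).
    rewrite (_ : r%:R = (8 ^ k)%:R * (2 ^ k)%:R :> R); last by rewrite -natrM -expnMn.
    rewrite -/r natrM le_eqVlt; apply/orP; left; apply/eqP; field.
    by rewrite !pnatr_eq0 -!lt0n !expn_gt0.
  by rewrite mulr_ge0 ?ler0n.
rewrite /rad_pairing; congr (_ * _ - _ * _).
  by do 3![apply: eq_bigr => ? _]; rewrite witness_shift.
by apply: eq_bigr => ? _; rewrite witness_shift.
Qed.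

End Witness.

(** * Decompositions into rank-one operators *)

Section RealParts.
Context {R : realType} {F : scalar_kind}.
Local Notation K := (scalar R F).
Implicit Types (z w : K) (t : R).

Definition sre z : R :=
  match F return scalar R F -> R with
  | RealScalars => id | ComplexScalars => @complex.Re R end z.

Definition sim z : R :=
  match F return scalar R F -> R with
  | RealScalars => fun=> 0 | ComplexScalars => @complex.Im R end z.

Lemma sreD : {morph sre : z w / z + w}.
Proof. by rewrite /sre; case: F => // -[a b] [c d]. Qed.

Lemma simD : {morph sim : z w / z + w}.
Proof. by rewrite /sim; case: F => [z w|[a b] [c d]] //; rewrite addr0. Qed.

Lemma sre0 : sre 0 = 0.
Proof. by rewrite /sre; case: F. Qed.

Lemma sim0 : sim 0 = 0.
Proof. by rewrite /sim; case: F. Qed.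

Lemma sreB z w : sre (z - w) = sre z - sre w.
Proof. by rewrite /sre; case: F z w => // -[a b] [c d]. Qed.

Lemma simB z w : sim (z - w) = sim z - sim w.
Proof. by rewrite /sim; case: F z w => [z w|[a b] [c d]] //; rewrite subr0. Qed.

Lemma sre_of_real t : sre (of_real F t) = t.
Proof. by rewrite /sre; case: F. Qed.

Lemma sreMl t z : sre (of_real F t * z) = t * sre z.
Proof. by rewrite /sre; case: F z => // -[a b] /=; rewrite mul0r subr0. Qed.

Lemma simMl t z : sim (of_real F t * z) = t * sim z.
Proof. by rewrite /sim; case: F z => [z|[a b]] /=; rewrite ?mulr0 // mul0r addr0. Qed.

Lemma sreMconj z w : sre (z * sconj w) = sre z * sre w + sim z * sim w.
Proof.
by rewrite /sre /sim; case: F z w => [z w|[a b] [c d]] /=; rewrite ?mulr0 ?addr0 // mulrN opprK.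
Qed.

Lemma simMconj z w : sim (z * sconj w) = sim z * sre w - sre z * sim w.
Proof.
rewrite /sre /sim; case: F z w => [z w|[a b] [c d]] /=; first by rewrite mulr0 mul0r subr0.
by rewrite mulrN addrC.
Qed.

Lemma sreMconj_self z : sre (z * sconj z) = sabs z ^+ 2.
Proof.
rewrite sreMconj /sre /sim /sabs; case: F z => [z|[a b]] /=.
  by rewrite mulr0 addr0 real_normK ?num_real ?expr2.
by rewrite sqr_sqrtr ?addr_ge0 ?sqr_ge0 // !expr2.
Qed.

Lemma sabs_sqr z : sabs z ^+ 2 = sre z ^+ 2 + sim z ^+ 2.
Proof. by rewrite -sreMconj_self sreMconj -!expr2. Qed.

Lemma ler_sre z : `|sre z| <= sabs z.
Proof.
rewrite -(@ler_pXn2r _ 2) ?nnegrE ?sabs_ge0 //.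
by rewrite sabs_sqr real_normK ?num_real // lerDl sqr_ge0.
Qed.

Lemma ler_sim z : `|sim z| <= sabs z.
Proof.
rewrite -(@ler_pXn2r _ 2) ?nnegrE ?sabs_ge0 //.
by rewrite sabs_sqr real_normK ?num_real // lerDr sqr_ge0.
Qed.

Lemma sabs_eq0 z : (sabs z == 0) = (z == 0).
Proof. by rewrite -(inj_eq (@of_real_inj R F)) -normr_sabs of_real0 normr_eq0. Qed.

Lemma scalar_ge0 z : (0 <= z) = (sim z == 0) && (0 <= sre z).
Proof. by rewrite /sre /sim; case: F z => [z|[a b]] /=; rewrite ?eqxx // lecE. Qed.

Lemma sabs_of_real t : sabs (of_real F t) = `|t|.
Proof. by rewrite /sabs; case: F => //=; rewrite expr0n addr0 sqrtr_sqr. Qed.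

(** Restating convergence through real-valued moduli lets later limits avoid a case distinction on
    the field. *)
Lemma cvg_sabs (u : nat -> K) l : u @ \oo --> l ->
  sabs (u n - l) @[n --> \oo] --> (0 : R).
Proof.
move/cvgrPdist_lt => ul; apply/cvgrPdist_lt => e e0.
have /ul : (0 : K) < of_real F e by rewrite -(@of_real0 R F) ltr_of_real.
apply: filterS => n; rewrite distrC normr_sabs ltr_of_real sub0r normrN.
by rewrite ger0_norm ?sabs_ge0.
Qed.

Lemma cvg_sre (u : nat -> K) l : sabs (u n - l) @[n --> \oo] --> (0 : R) ->
  sre (u n) @[n --> \oo] --> sre l.
Proof.
move=> /cvgrPdist_lt ul; apply/cvgrPdist_lt => e /ul; apply: filterS => n.
rewrite sub0r normrN ger0_norm ?sabs_ge0 // distrC -sreB.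
exact: le_lt_trans (ler_sre _).
Qed.

Lemma cvg_sim (u : nat -> K) l : sabs (u n - l) @[n --> \oo] --> (0 : R) ->
  sim (u n) @[n --> \oo] --> sim l.
Proof.
move=> /cvgrPdist_lt ul; apply/cvgrPdist_lt => e /ul; apply: filterS => n.
rewrite sub0r normrN ger0_norm ?sabs_ge0 // distrC -simB.
exact: le_lt_trans (ler_sim _).
Qed.

End RealParts.

Section NonnegativeSeries.
Context {R : realType}.
Implicit Types (u : nat -> R) (M : R).

Lemma psum_le_nneseries u n M : (forall k, 0 <= u k) ->
  (\sum_(0 <= k <oo) (u k)%:E <= M%:E)%E -> \sum_(0 <= k < n) u k <= M.
Proof.
move=> u0 uM; rewrite -lee_fin; apply: le_trans uM; rewrite -sumEFin.
by apply: nneseries_lim_ge => k _ _; rewrite lee_fin.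
Qed.

Lemma nneseries_le_psum u M : (forall k, 0 <= u k) ->
  (forall n, \sum_(0 <= k < n) u k <= M) -> (\sum_(0 <= k <oo) (u k)%:E <= M%:E)%E.
Proof.
move=> u0 uM; apply: lime_le; first by apply: is_cvg_nneseries => k _ _; rewrite lee_fin.
by near=> n; rewrite sumEFin lee_fin.
Unshelve. all: by end_near. Qed.

End NonnegativeSeries.

Section Coordinates.
Context {R : realType} {F : scalar_kind}.
Local Notation K := (scalar R F).
Local Notation H := (l2 R F).
Implicit Types (x y z v : H).

Lemma sum_l2E (f : nat -> H) n j : (\sum_(0 <= k < n) f k) j = \sum_(0 <= k < n) f k j.
Proof. by elim/big_ind2: _ => // _ y _ z <- <-. Qed.

Lemma l2_eq x y : (forall j, x j = y j) -> x = y.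
Proof. by move=> xy; apply: val_inj; apply/funext. Qed.

Lemma limn_series_single (u : nat -> K) j : (forall k, k != j -> u k = 0) ->
  limn (series u) = u j.
Proof.
move=> u0; apply: lim_near_cst; first exact: norm_hausdorff.
near=> n; rewrite /series /= big_mkord.
have jn : (j < n)%N by near: n; exact: nbhs_infty_gt.
by rewrite (bigD1 (Ordinal jn)) //= big1 ?addr0 // => k; rewrite -val_eqE => /u0.
Unshelve. all: by end_near. Qed.

Lemma inner_deltar x j : inner x (delta j) = x j.
Proof.
rewrite /inner (@limn_series_single _ j) /= => [|k /negPf->].
  by rewrite eqxx -(@of_real1 R F) sconj_real of_real1 mulr1.
by rewrite sconj0 mulr0.
Qed.

Lemma inner_deltal x j : inner (delta j) x = sconj (x j).
Proof.
rewrite /inner (@limn_series_single _ j) /= => [|k /negPf->]; last by rewrite mul0r.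
by rewrite eqxx mul1r.
Qed.

Lemma psum_le_l2norm x n : \sum_(0 <= k < n) sabs (x k) ^+ 2 <= l2norm x ^+ 2.
Proof.
rewrite sqr_l2norm; apply: psum_le_nneseries => [k|]; first exact: sqr_ge0.
by rewrite fineK ?sqsum_fin.
Qed.

Lemma coord_le_l2norm x j : sabs (x j) <= l2norm x.
Proof.
rewrite -(@ler_pXn2r _ 2) ?nnegrE ?sabs_ge0 ?l2norm_ge0 //.
apply: le_trans (psum_le_l2norm x j.+1); rewrite big_nat_recr //= lerDr.
by apply: sumr_ge0 => k _; exact: sqr_ge0.
Qed.

Lemma l2norm0 : l2norm (0 : H) = 0.
Proof. by rewrite -[X in l2norm X](scale0r 0) l2normZ sabs0 mul0r. Qed.

Lemma l1norm_ge0 x : (0 <= l1norm x)%E.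
Proof. by apply: nneseries_ge0 => k _ _; rewrite lee_fin sabs_ge0. Qed.

Lemma l1normZ a x : l1norm (a *: x) = ((sabs a)%:E * l1norm x)%E.
Proof.
rewrite -nneseriesZl => [|k _]; last by rewrite lee_fin sabs_ge0.
by apply: eq_eseriesr => k _; rewrite -EFinM -sabsM.
Qed.

Definition l1real x : R := fine (l1norm x).

Lemma l1real_ge0 x : 0 <= l1real x.
Proof. by rewrite fine_ge0 ?l1norm_ge0. Qed.

Lemma l1realK x : (l1norm x < +oo)%E -> (l1real x)%:E = l1norm x.
Proof. by move=> xoo; rewrite fineK // ge0_fin_numE ?l1norm_ge0. Qed.

Lemma psum_le_l1real x n : (l1norm x < +oo)%E ->
  \sum_(0 <= i < n) sabs (x i) <= l1real x.
Proof.
move=> xoo; apply: psum_le_nneseries => [k|]; first exact: sabs_ge0.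
by rewrite l1realK.
Qed.

Lemma coord_le_l1real x i : (l1norm x < +oo)%E -> sabs (x i) <= l1real x.
Proof.
move=> xoo; apply: le_trans (psum_le_l1real i.+1 xoo); rewrite big_nat_recr //= lerDr.
by apply: sumr_ge0 => k _; exact: sabs_ge0.
Qed.

End Coordinates.

Section Decompositions.
Context {R : realType} {F : scalar_kind}.
Local Notation K := (scalar R F).
Local Notation H := (l2 R F).
Local Notation V := (opV R F).
Implicit Types (x y : nat -> H) (A B : V) (v : H) (a b t : R).

Definition decomposes x A :=
  (forall k, (l1norm (x k) < +oo)%E) /\ strong_sum (fun k => rank_one (x k)) A.

Definition cost x : \bar R := (\sum_(0 <= k <oo) l1norm (x k) ^+ 2)%E.

Lemma costE x : (forall k, (l1norm (x k) < +oo)%E) ->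
  cost x = (\sum_(0 <= k <oo) (l1real (x k) ^+ 2)%:E)%E.
Proof. by move=> xoo; apply: eq_eseriesr => k _; rewrite EFin_expe l1realK. Qed.

Lemma cost_ge0 x : (0 <= cost x)%E.
Proof. by apply: nneseries_ge0 => k _ _; rewrite expe_ge0 ?l1norm_ge0. Qed.

Lemma cost_leP x a : (forall k, (l1norm (x k) < +oo)%E) ->
  (cost x <= a%:E)%E <-> forall n, \sum_(0 <= k < n) l1real (x k) ^+ 2 <= a.
Proof.
move=> xoo; rewrite costE //; split=> h.
  by move=> n; apply: psum_le_nneseries => // k; exact: sqr_ge0.
by apply: nneseries_le_psum => // k; exact: sqr_ge0.
Qed.

(** A strict bound on the infimum is witnessed by one decomposition; later arguments work with that
    decomposition and its cost. *)
Lemma gamma_plus_ltP A (e : \bar R) :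
  (gamma_plus A < e)%E <-> exists2 x, decomposes x A & (cost x < e)%E.
Proof.
split=> [/ereal_inf_lt[_ [x [xoo sx ->]] xe]|[x [xoo sx] xe]]; first by exists x.
by apply: le_lt_trans xe; apply: ereal_inf_lbound; exists x.
Qed.

Lemma U_plusP A (e : R) :
  U_plus e A <-> Gamma A /\ exists2 x, decomposes x A & (cost x < e%:E)%E.
Proof.
rewrite /U_plus /Gamma_plus /=; split=> [[[GA _] /gamma_plus_ltP]//|[GA /gamma_plus_ltP h]].
by split=> //; split=> //; exact: lt_trans h (ltry _).
Qed.

Lemma U_plus_Gamma_plus A (e : R) : U_plus e A -> Gamma_plus A.
Proof. by case. Qed.

(** Strong convergence is tested on [delta i] and read in coordinate j, which the l2-norm
    dominates. *)
Lemma decomposes_cvg x A i j : decomposes x A ->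
  sabs (\sum_(0 <= k < n) sconj (x k i) * x k j - A (delta i) j) @[n --> \oo] --> (0 : R).
Proof.
move=> [_ /(_ (delta i)) sx]; apply: squeeze_cvgr (cvg_cst 0) sx.
near=> n; rewrite sabs_ge0 /=; apply: le_trans (coord_le_l2norm _ j).
rewrite [X in _ <= sabs X](_ : _ = \sum_(0 <= k < n) sconj (x k i) * x k j - A (delta i) j) //.
rewrite -[LHS]/((\sum_(0 <= k < n) rank_one (x k) (delta i)) j - _) sum_l2E.
congr (_ - _); apply: eq_bigr => k _.
by rewrite -inner_deltal.
Unshelve. all: by end_near. Qed.

(** Every term is at most the squared l1-norm of its vector, so the partial sums stay below a. This
    bound later separates points. *)
Lemma decomposes_entry x A i j a : decomposes x A -> (cost x <= a%:E)%E ->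
  sabs (A (delta i) j) <= a.
Proof.
move=> dx; have [xoo _] := dx; move/(cost_leP _ xoo) => xa.
apply/ler_addgt0Pr => e e0.
have /cvgrPdist_lt/(_ _ e0)[n _ /(_ n (leqnn _))] := decomposes_cvg i j dx.
rewrite /= sub0r normrN ger0_norm ?sabs_ge0 //.
set S := \sum_(0 <= k < n) _ => Sn.
have SA : sabs S <= a.
  apply: le_trans (xa n); rewrite /S; elim/big_ind2: _ => [|p q r s pq rs|k _].
  - by rewrite sabs0.
  - by apply: le_trans (ler_sabsD _ _) _; exact: lerD.
  - by rewrite sabsM sabs_conj expr2 ler_pM ?sabs_ge0 ?coord_le_l1real.
rewrite -(opprK (A _ _)) sabsN -[- _](addKr S) addrC.
apply: le_trans (ler_sabsD _ _) _; rewrite addrC lerD ?sabsN //.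
by rewrite ltW.
Qed.

Definition interleave (T : Type) (x y : nat -> T) k := if odd k then y k./2 else x k./2.

Lemma sum_interleave (T : Type) (W : nmodType) (f : T -> W) (x y : nat -> T) n :
  \sum_(0 <= k < n) f (interleave x y k) =
  \sum_(0 <= k < uphalf n) f (x k) + \sum_(0 <= k < n./2) f (y k).
Proof.
elim: n => [|n ih]; first by rewrite !big_geq // addr0.
rewrite big_nat_recr //= ih /interleave; have := uphalf_half n.
case: (odd n) => -> /=; rewrite ?add1n ?add0n.
  by rewrite -addrA; congr (_ + _); rewrite big_nat_recr.
by rewrite addrAC; congr (_ + _); rewrite big_nat_recr.
Qed.

Lemma decomposesD x y A B : decomposes x A -> decomposes y B ->
  decomposes (interleave x y) (A + B).
Proof.
move=> [xoo sx] [yoo sy]; split=> [k|v]; first by rewrite /interleave; case: ifP.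
have cx : l2norm (\sum_(0 <= k < uphalf n) rank_one (x k) v - A v) @[n --> \oo] --> (0 : R).
  apply: (cvg_comp uphalf _ _ (sx v)); apply/cvgnyPge => M; near=> n.
  by rewrite geq_uphalf_double; apply: leqW; near: n; exact: nbhs_infty_ge.
have cy : l2norm (\sum_(0 <= k < n./2) rank_one (y k) v - B v) @[n --> \oo] --> (0 : R).
  apply: (cvg_comp half _ _ (sy v)); apply/cvgnyPge => M; near=> n.
  by rewrite geq_half_double; near: n; exact: nbhs_infty_ge.
(* The factor 2 is the constant in [ler_l2normD]; it is harmless in the limit. *)
have := cvgM (cvg_cst (2 : R)) (cvgD cx cy); rewrite addr0 mulr0.
move=> /(_ _ _ _) h; apply: squeeze_cvgr (cvg_cst 0) h; near=> n.
apply/andP; split; first exact: l2norm_ge0.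
rewrite (sum_interleave (fun z => rank_one z v)) [X in l2norm (_ - X)](_ : _ = A v + B v) //.
rewrite opprD addrACA.
exact: ler_l2normD.
Unshelve. all: by end_near. Qed.

Lemma costD x y A B a b : decomposes x A -> decomposes y B ->
  (cost x <= a%:E)%E -> (cost y <= b%:E)%E -> (cost (interleave x y) <= (a + b)%:E)%E.
Proof.
move=> dx dy; have [zoo _] := decomposesD dx dy.
case: dx dy => xoo _ [yoo _] /(cost_leP _ xoo) xa /(cost_leP _ yoo) yb.
apply/(cost_leP _ zoo) => n.
by rewrite (sum_interleave (fun z => l1real z ^+ 2)) lerD.
Qed.

Lemma Gamma0 : Gamma (0 : V).
Proof. by move=> v; rewrite -[X in inner X]/(0 : H) -(scale0r (0 : H)) innerZl mul0r. Qed.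

Lemma GammaD A B : Gamma A -> Gamma B -> Gamma (A + B).
Proof. by move=> GA GB v; rewrite -[(A + B) v]/(A v + B v) innerDl addr_ge0. Qed.

Lemma GammaZ t A : 0 <= t -> Gamma A -> Gamma (t *: A).
Proof.
move=> t0 GA v; rewrite -[(t *: A) v]/(of_real F t *: A v) innerZl mulr_ge0 //.
by rewrite -(@of_real0 R F) ler_of_real.
Qed.

Lemma decomposes0 : decomposes (fun=> 0) (0 : V).
Proof.
have n0 : l1norm (0 : H) = 0%E.
  by rewrite -(scale0r (0 : H)) l1normZ sabs0 mul0e.
split=> [k|v]; first by rewrite n0 ltry.
apply: cvg_near_cst; near=> n.
by rewrite big1 ?subr0 ?l2norm0 // => k _; rewrite /rank_one scaler0.
Unshelve. all: by end_near. Qed.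

Lemma cost0 : cost (fun=> 0) = 0%E.
Proof.
rewrite /cost eseries0 // => k _ _.
by rewrite -(scale0r (0 : H)) l1normZ sabs0 mul0e expe2 mul0e.
Qed.

Lemma U_plus0 (e : R) : 0 < e -> U_plus e (0 : V).
Proof.
move=> e0; apply/U_plusP; split; first exact: Gamma0.
by exists (fun=> 0); [exact: decomposes0|rewrite cost0 lte_fin].
Qed.

(** Costs add under interleaving, so the room that a decomposition of A leaves below e is available
    to B. This is what makes the translates of [U_plus e] neighbourhoods of all their points. *)
Lemma U_plus_nbhs A (e : R) : U_plus e A ->
  exists2 r, 0 < r & forall B, U_plus r B -> U_plus e (A + B).
Proof.
move=> /U_plusP[GA [x dx xe]].
have xfin : cost x \is a fin_num by rewrite ge0_fin_numE ?cost_ge0 // (lt_trans xe) ?ltry.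
move: xe; rewrite -(fineK xfin) lte_fin -subr_gt0 => xe.
exists (e - fine (cost x)) => // B /U_plusP[GB [y dy ye]].
have yfin : cost y \is a fin_num by rewrite ge0_fin_numE ?cost_ge0 // (lt_trans ye) ?ltry.
apply/U_plusP; split; first exact: GammaD.
exists (interleave x y); first exact: decomposesD.
apply: (@le_lt_trans _ _ (fine (cost x) + fine (cost y))%:E).
  by apply: (costD dx dy); rewrite fineK.
by rewrite lte_fin -ltrBrDl -lte_fin fineK.
Qed.

(** The vectors are scaled by the square root of t, since rank-one operators and costs are quadratic
    in them. *)
Lemma Gamma_plusZ t A : 0 <= t -> Gamma_plus A -> Gamma_plus (t *: A).
Proof.
move=> t0 [GA /gamma_plus_ltP[x [xoo sx] xfin]]; split; first exact: GammaZ.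
pose s := of_real F (Num.sqrt t).
have soo k : (l1norm (s *: x k) < +oo)%E.
  by rewrite l1normZ lte_mul_pinfty // lee_fin sabs_ge0.
have sl k : l1real (s *: x k) ^+ 2 = t * l1real (x k) ^+ 2.
  have xf : l1norm (x k) \is a fin_num by rewrite ge0_fin_numE ?l1norm_ge0.
  rewrite /l1real l1normZ fineM //= exprMn.
  by rewrite sabs_of_real real_normK ?num_real // sqr_sqrtr.
apply/gamma_plus_ltP; exists (fun k => s *: x k); [split=> // v|].
  have h : sabs (of_real F t) * l2norm (\sum_(0 <= k < n) rank_one (x k) v - A v)
      @[n --> \oo] --> (0 : R).
    by rewrite -(mulr0 (sabs (of_real F t))); apply: cvgM (sx v); exact: cvg_cst.
  apply: cvg_trans h; apply: near_eq_cvg; apply: nearW => n.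
  have rk k : rank_one (s *: x k) v = of_real F t *: rank_one (x k) v.
    rewrite /rank_one innerZr !scalerA sconj_real -mulrA mulrCA mulrC -of_realM -expr2.
    by rewrite sqr_sqrtr.
  have tA : (t *: A) v = of_real F t *: A v by [].
  have E : \sum_(0 <= k < n) rank_one (s *: x k) v - (t *: A) v =
      of_real F t *: (\sum_(0 <= k < n) rank_one (x k) v - A v).
    rewrite tA [in RHS]scalerBr scaler_sumr; congr (_ - _).
    by apply: eq_bigr => k _; exact: rk.
  by rewrite [RHS](congr1 l2norm E) l2normZ.
have xf : cost x \is a fin_num by rewrite ge0_fin_numE ?cost_ge0.
apply: le_lt_trans (ltry (t * fine (cost x))); apply/(cost_leP _ soo) => n.
under eq_bigr do rewrite sl.
rewrite -mulr_sumr ler_wpM2l //; apply: (cost_leP _ xoo).1.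
by rewrite fineK.
Qed.

(** By self-adjointness, coordinate j of A v is the inner product of v with A (delta j), which is
    0. *)
Lemma opV_entries_eq0 A : (forall i j, A (delta i) j = 0) -> A = 0.
Proof.
move=> A0; apply: val_inj; apply/funext => v; apply: l2_eq => j.
have /opV_predP[_ _ sA _] := opV_funP A.
rewrite -[LHS]inner_deltar sA (_ : A (delta j) = 0); last by apply: l2_eq.
by rewrite -(scale0r (0 : H)) innerZr sconj0 mul0r.
Qed.

Lemma sre_entry_ge0 A i : Gamma A -> 0 <= sre (A (delta i) i).
Proof. by move=> /(_ (delta i)); rewrite inner_deltar scalar_ge0 => /andP[]. Qed.

(* The diagonal of A vanishes, hence so does every vector of a decomposition. *)
Lemma Gamma_plus_antisym A : Gamma_plus A -> Gamma (- A) -> A = 0.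
Proof.
move=> [GA /gamma_plus_ltP[x dx _]] GNA.
have A0 i : sre (A (delta i) i) = 0.
  apply/eqP; rewrite eq_le sre_entry_ge0 // andbT.
  have := sre_entry_ge0 i GNA; rewrite -[(- A) _ i]/(- A (delta i) i).
  by rewrite -sub0r sreB sre0 sub0r oppr_ge0.
have x0 k i : x k i = 0.
  apply/eqP; rewrite -sabs_eq0 -sqrf_eq0 eq_le sqr_ge0 andbT -(A0 i).
  have /cvg_sre cA := decomposes_cvg i i dx.
  rewrite -(cvg_lim _ cA) //; apply: limr_ge; first by apply/cvg_ex; eexists; exact: cA.
  near=> n; have kn : (k < n)%N by near: n; exact: nbhs_infty_gt.
  rewrite (big_morph _ (@sreD R F) (@sre0 R F)) big_mkord.
  rewrite (bigD1 (Ordinal kn)) //= mulrC sreMconj_self lerDl sumr_ge0 // => l _.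
  by rewrite mulrC sreMconj_self sqr_ge0.
apply: opV_entries_eq0 => i j; apply/eqP; rewrite -sabs_eq0.
have := decomposes_cvg i j dx.
under eq_fun do (rewrite big1 => [|k _]; last by rewrite !x0 mulr0).
rewrite sub0r sabsN => /(cvg_lim _) <- //.
by rewrite lim_cst.
Unshelve. all: by end_near. Qed.

End Decompositions.

(** * Operators given by block-diagonal matrices *)

Lemma sum_sqr_le (R : realDomainType) (u : nat -> R) n : (forall k, 0 <= u k) ->
  \sum_(0 <= k < n) u k ^+ 2 <= (\sum_(0 <= k < n) u k) ^+ 2.
Proof.
move=> u0; elim: n => [|n ih]; first by rewrite !big_geq // expr0n.
rewrite !big_nat_recr //= sqrrD; apply: lerD => //; apply: (le_trans ih).
by rewrite lerDl mulrn_wge0 // mulr_ge0 // sumr_ge0.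
Qed.

Section MatrixOperator.
Context {R : realType} {F : scalar_kind}.
Local Notation K := (scalar R F).
Local Notation H := (l2 R F).
Local Notation V := (opV R F).
Context {a : nat -> nat -> R} {M : R}.
Context (a_block : block_diagonal a).
Context (aC : forall i j, a i j = a j i).
Context (aM : forall r, \sum_(i < 2 ^ r) \sum_(j < 2 ^ r) `|a i j| <= M).
Implicit Types (x y : H) (i j k n r : nat).

Let rho i := \sum_(j < 2 ^ dyadic_block i) `|a i j|.

Let rho_ge0 i : 0 <= rho i. Proof. exact: sumr_ge0. Qed.

Let rhoE i r : (i < 2 ^ r)%N -> rho i = \sum_(j < 2 ^ r) `|a i j|.
Proof.
apply: (@block_diagonal_row _ (fun i j => `|a i j|)) => p q pq.
by rewrite a_block // normr0.
Qed.

Let psum_row i n : \sum_(0 <= j < n) `|a i j| <= rho i.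
Proof.
have ir : (i < 2 ^ (n + i))%N.
  by apply: (leq_ltn_trans (leq_addl n i)); exact: ltn_expl.
rewrite (rhoE ir) -(big_mkord xpredT (fun j => `|a i j|)).
rewrite [leRHS](@big_cat_nat _ _ _ n) //= ?lerDl ?sumr_ge0 //.
by apply: (leq_trans (leq_addr i n)); rewrite ltnW // ltn_expl.
Qed.

Let psum_rho n : \sum_(0 <= i < n) rho i <= M.
Proof.
apply: le_trans (aM n); rewrite -(big_mkord xpredT (fun i => \sum_(j < 2 ^ n) `|a i j|)).
have nn : (n <= 2 ^ n)%N by rewrite ltnW // ltn_expl.
rewrite [leRHS](@big_cat_nat _ _ _ n) //=.
rewrite -[leLHS]addr0 lerD ?sumr_ge0 // => [|i _]; last by rewrite sumr_ge0.
rewrite !big_nat; apply: ler_sum => i /andP[_ ni].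
by rewrite (@rhoE i n) // (leq_trans ni).
Qed.

Let M_ge0 : 0 <= M.
Proof. by have := psum_rho 0; rewrite big_geq. Qed.

(* Row i is supported in [0, 2 ^ dyadic_block i), so the sum may be finite. *)
Definition mx_apply (b : nat -> nat -> R) (x : nat -> K) i : K :=
  \sum_(j < 2 ^ dyadic_block i) of_real F (b i j) * x j.

Let mx_apply_bound x i : sabs (mx_apply a x i) <= rho i * l2norm x.
Proof.
rewrite /mx_apply /rho mulr_suml; elim/big_ind2: _ => [|p q r s pq rs|j _].
- by rewrite sabs0.
- by apply: le_trans (ler_sabsD _ _) _; exact: lerD.
- by rewrite sabsM sabs_of_real ler_wpM2l ?coord_le_l2norm.
Qed.

(** Coordinate i is at most [rho i] times the norm of x, and the l2-norm of the row sums is at most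
    their l1-norm, hence at most M. *)
Let mx_apply_sqsum x : (sqsum (mx_apply a x) <= ((M * l2norm x) ^+ 2)%:E)%E.
Proof.
apply: nneseries_le_psum => [k|n]; first exact: sqr_ge0.
apply: (@le_trans _ _ (\sum_(0 <= k < n) (rho k * l2norm x) ^+ 2)).
  by apply: ler_sum => k _; rewrite lerXn2r ?nnegrE ?mulr_ge0 ?l2norm_ge0 ?sabs_ge0.
apply: le_trans (sum_sqr_le _ _) _ => [k|]; first by rewrite mulr_ge0 ?l2norm_ge0.
rewrite -mulr_suml lerXn2r ?nnegrE ?mulr_ge0 ?l2norm_ge0 ?sumr_ge0 //.
by rewrite ler_wpM2r ?l2norm_ge0.
Qed.

Let mx_apply_l2 x : mx_apply a x \in @l2_pred R F.
Proof. by apply/l2_predP; apply: le_lt_trans (mx_apply_sqsum x) (ltry _). Qed.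

Definition mx_fun x : H := L2 (mx_apply_l2 x).

Let mx_fun_linear : linear mx_fun.
Proof.
move=> c x y; apply: l2_eq => i.
rewrite -[RHS]/(c * mx_apply a x i + mx_apply a y i) /= /mx_apply mulr_sumr -big_split /=.
by apply: eq_bigr => j _; rewrite mulrDr mulrCA.
Qed.

Let mx_fun_bounded : bounded_op mx_fun.
Proof.
exists M => x; rewrite -(@ler_pXn2r _ 2) ?nnegrE ?mulr_ge0 ?l2norm_ge0 //.
by rewrite sqr_l2norm -lee_fin fineK ?sqsum_fin //; exact: mx_apply_sqsum.
Qed.

Lemma mx_fun_delta i k : mx_fun (delta k) i = of_real F (a i k).
Proof.
rewrite /= /mx_apply; have [ki|ik] := ltnP k (2 ^ dyadic_block i).
  rewrite (bigD1 (Ordinal ki)) //= eqxx mulr1 big1 ?addr0 // => j.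
  by rewrite -val_eqE /= => /negPf->; rewrite mulr0.
rewrite big1 => [|j _]; last first.
  by rewrite (_ : (_ == _) = false) ?mulr0 //; apply/ltn_eqF/(leq_trans (ltn_ord j)).
rewrite a_block ?of_real0 //; apply: contraTN ik => /eqP ->.
by rewrite -ltnNge dyadic_block_gt.
Qed.

(** Truncating at 2 ^ r never cuts a block, so along this subsequence the form of the operator is a
    finite sum over a square. *)
Lemma cvg_inner_dyadic x y :
  \sum_(i < 2 ^ r) x i * sconj (y i) @[r --> \oo] --> inner x y.
Proof.
have h : (fun r => 2 ^ r)%N @ \oo --> \oo.
  apply/cvgnyPge => N; near=> n.
  by rewrite (@leq_trans n) ?(ltnW (ltn_expl _ _)) //; near: n; exact: nbhs_infty_ge.
have := cvg_comp _ _ h (@cvg_inner R F x y).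
apply: cvg_trans; apply: near_eq_cvg; apply: nearW => r.
by rewrite /= /series /= big_mkord.
Unshelve. all: by end_near. Qed.

Lemma psum_mx_fun x y r : \sum_(i < 2 ^ r) mx_fun x i * sconj (y i) =
  \sum_(i < 2 ^ r) \sum_(j < 2 ^ r) of_real F (a i j) * (x j * sconj (y i)).
Proof.
apply: eq_bigr => i _; rewrite /= /mx_apply.
rewrite (@block_diagonal_row _ (fun i j => of_real F (a i j) * x j) i r) //.
  by rewrite mulr_suml; apply: eq_bigr => j _; rewrite mulrA.
by move=> p q pq; rewrite a_block // of_real0 mul0r.
Qed.

Let mx_fun_self_adjoint : self_adjoint mx_fun.
Proof.
move=> x y; have c1 := @cvg_inner_dyadic (mx_fun x) y.
have c2 := @cvg_inner_dyadic x (mx_fun y).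
rewrite -(cvg_lim (@norm_hausdorff _ _) c1) -(cvg_lim (@norm_hausdorff _ _) c2).
(* By symmetry of the matrix, the two sides agree already at each truncation. *)
congr (limn _); apply/funext => r.
rewrite psum_mx_fun exchange_big /=; apply: eq_bigr => j _.
rewrite /= /mx_apply.
rewrite (@block_diagonal_row _ (fun i j => of_real F (a i j) * y j) j r) //; last first.
  by move=> p q pq; rewrite a_block // of_real0 mul0r.
rewrite (big_morph _ (@sconjD R F) (@sconj0 R F)) mulr_sumr; apply: eq_bigr => i _.
by rewrite sconjM sconj_real aC mulrCA.
Qed.

Let mx_fun_norm11 : (norm11 mx_fun < +oo)%E.
Proof.
apply: (@le_lt_trans _ _ M%:E); last exact: ltry.
apply: (@le_trans _ _ (\sum_(0 <= k <oo) (rho k)%:E)%E); last exact: nneseries_le_psum.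
apply: lee_nneseries => [k _ _|k _].
  by apply: nneseries_ge0 => l _ _; rewrite lee_fin sabs_ge0.
apply: nneseries_le_psum => [l|n]; first exact: sabs_ge0.
apply: le_trans (psum_row k n); apply: ler_sum => l _.
by rewrite inner_deltar mx_fun_delta sabs_of_real aC.
Qed.

Lemma mx_fun_opV : mx_fun \in @opV_pred R F.
Proof. exact/opV_predP. Qed.

Definition mx_op : V := OpV mx_fun_opV.

(** In each truncation the imaginary part cancels by antisymmetry in (i, j), and the real part is
    the form at the real parts of x plus the form at its imaginary parts. Both properties pass to
    the limit. *)
Lemma Gamma_mx_op :
  (forall r (u : nat -> R), 0 <= \sum_(i < 2 ^ r) \sum_(j < 2 ^ r) a i j * (u i * u j)) ->
  Gamma mx_op.
Proof.
move=> psd x; rewrite scalar_ge0.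
have /cvg_sabs cS := @cvg_inner_dyadic (mx_fun x) x.
have sum2 (f : K -> R) (fD : {morph f : z w / z + w}) (f0 : f 0 = 0) r (G : 'I_(2 ^ r) -> 'I_(2 ^ r) -> K) :
    f (\sum_(i < 2 ^ r) \sum_(j < 2 ^ r) G i j) = \sum_(i < 2 ^ r) \sum_(j < 2 ^ r) f (G i j).
  by rewrite (big_morph _ fD f0); apply: eq_bigr => i _; rewrite (big_morph _ fD f0).
apply/andP; split.
  apply/eqP; have cI := cvg_sim cS; rewrite -(cvg_lim _ cI) //.
  rewrite (_ : (fun n => _) = fun=> 0); first exact: lim_cst.
  apply/funext => r; rewrite psum_mx_fun (sum2 _ (@simD R F) (@sim0 R F)).
  pose T i j := a i j * (sim (x j) * sre (x i)).
  transitivity (\sum_(i < 2 ^ r) \sum_(j < 2 ^ r) (T i j - T j i)).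
    apply: eq_bigr => i _; apply: eq_bigr => j _.
    by rewrite simMl simMconj /T (aC j i) -mulrBr [sre (x j) * _]mulrC.
  under eq_bigr do rewrite sumrB.
  by rewrite sumrB [X in _ - X]exchange_big subrr.
have cR := cvg_sre cS; rewrite -(cvg_lim _ cR) //.
apply: limr_ge; first by apply/cvg_ex; eexists; exact: cR.
apply: nearW => r; rewrite psum_mx_fun (sum2 _ (@sreD R F) (@sre0 R F)).
rewrite (_ : \sum_(i < _) _ =
  \sum_(i < 2 ^ r) \sum_(j < 2 ^ r) a i j * (sre (x i) * sre (x j)) +
  \sum_(i < 2 ^ r) \sum_(j < 2 ^ r) a i j * (sim (x i) * sim (x j))).
  by rewrite addr_ge0 ?(psd r (fun i => sre (x i))) ?(psd r (fun i => sim (x i))).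
rewrite -big_split; apply: eq_bigr => i _; rewrite -big_split; apply: eq_bigr => j _ /=.
by rewrite sreMl sreMconj; ring.
Qed.

End MatrixOperator.

(** * The operator A0 outside Gamma_plus *)

Section Witness.
Context {R : realType} {F : scalar_kind}.
Local Notation K := (scalar R F).
Local Notation H := (l2 R F).
Local Notation V := (opV R F).

Definition witness_op : V :=
  mx_op (F := F) (@witness_block R) (@witnessC R) (@witness_norm R).

Lemma Gamma_witness_op : Gamma witness_op.
Proof. apply: Gamma_mx_op; exact: witness_psd. Qed.

Lemma cvg_sum_fin (I : finType) (f : I -> nat -> R) (l : I -> R) :
  (forall i, f i n @[n --> \oo] --> l i) ->
  \sum_(i : I) f i n @[n --> \oo] --> \sum_(i : I) l i.
Proof. by move=> fl; apply: cvg_big => //; exact: add_continuous. Qed.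

Lemma cvg_rad_pairing r (N : nat -> nat -> nat -> R) (L : nat -> nat -> R) :
  (forall i j, N n i j @[n --> \oo] --> L i j) ->
  rad_pairing r (N n) @[n --> \oo] --> rad_pairing r L.
Proof.
move=> NL; rewrite /rad_pairing; apply: cvgB; apply: cvgM; do ?exact: cvg_cst.
  do 3![apply: cvg_sum_fin => ?]; apply: cvgM; [exact: cvg_cst|exact: NL].
by apply: cvg_sum_fin => ?; exact: NL.
Qed.

(** Each term is a sum of two real rank-one matrices, built from the real and the imaginary parts of
    the vector. Both pairings are at most its squared l1-norm, whence the factor 2. *)
Lemma rad_pairing_decomposition r (x : nat -> H) n : (forall k, (l1norm (x k) < +oo)%E) ->
  rad_pairing r (fun i j => \sum_(0 <= k < n)
    sre (sconj (x k (2 ^ r + i)%N) * x k (2 ^ r + j)%N))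
  <= 2 * \sum_(0 <= k < n) l1real (x k) ^+ 2.
Proof.
move=> xoo.
have half (f : K -> R) k : (forall z, `|f z| <= sabs z) ->
  rad_pairing r (fun i j => f (x k (2 ^ r + i)%N) * f (x k (2 ^ r + j)%N)) <= l1real (x k) ^+ 2.
  move=> fs; apply: le_trans (rad_pairing_rank1 r (fun i => f (x k (2 ^ r + i)%N))) _.
  rewrite lerXn2r ?nnegrE ?sumr_ge0 ?l1real_ge0 //.
  apply: le_trans (psum_le_l1real (2 ^ r.+1) (xoo k)).
  rewrite big_mkord (sum_double (fun i => sabs (x k i))) -[leLHS]add0r lerD //.
    by rewrite sumr_ge0 // => i _; exact: sabs_ge0.
  by apply: ler_sum => i _; exact: fs.
elim: n => [|n ih].
  rewrite big_geq // mulr0 /rad_pairing big1 => [|k _]; last first.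
    by rewrite big1 // => i _; rewrite big1 // => j _; rewrite big_geq ?mulr0.
  by rewrite big1 ?mulr0 ?subr0 // => i _; rewrite big_geq.
rewrite big_nat_recr //= mulrDr.
rewrite (_ : (fun i j => _) = fun i j => \sum_(0 <= k < n)
    sre (sconj (x k (2 ^ r + i)%N) * x k (2 ^ r + j)%N) +
    (sre (x n (2 ^ r + i)%N) * sre (x n (2 ^ r + j)%N) +
     sim (x n (2 ^ r + i)%N) * sim (x n (2 ^ r + j)%N))); last first.
  apply/funext => i; apply/funext => j; rewrite big_nat_recr //=; congr (_ + _).
  by rewrite mulrC sreMconj; ring.
rewrite !rad_pairingD lerD // mulr_natl mulr2n lerD //.
  by apply: half; exact: ler_sre.
by apply: half; exact: ler_sim.
Qed.

(** A pairing involves finitely many entries, so it passes to the limit of the partial sums. A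
    decomposition of finite cost s would bound all pairings by 2 s, but they grow like 2 ^ k. *)
Lemma witness_op_not_Gamma_plus : ~ Gamma_plus witness_op.
Proof.
move=> [_ /gamma_plus_ltP[x dx xfin]]; have [xoo _] := dx.
have xf : cost x \is a fin_num by rewrite ge0_fin_numE ?cost_ge0.
pose s := fine (cost x).
have s_ge n : \sum_(0 <= k < n) l1real (x k) ^+ 2 <= s.
  by apply: (cost_leP _ xoo).1; rewrite fineK.
have bound k : (2 ^ k)%:R / 8 <= 2 * s.
  apply: le_trans (witness_pairing k) _; set r := (16 ^ k)%N.
  have c : rad_pairing r (fun i j => \sum_(0 <= k < n)
      sre (sconj (x k (2 ^ r + i)%N) * x k (2 ^ r + j)%N)) @[n --> \oo]
      --> rad_pairing r (fun i j => witness (2 ^ r + i)%N (2 ^ r + j)%N : R).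
    apply: cvg_rad_pairing => i j.
    have := cvg_sre (decomposes_cvg (2 ^ r + i) (2 ^ r + j) dx).
    rewrite -[witness_op _ _]/(mx_fun _ _ _ _) mx_fun_delta.
    rewrite sre_of_real witnessC.
    apply: cvg_trans; apply: near_eq_cvg; apply: nearW => n.
    by rewrite (big_morph _ (@sreD R F) (@sre0 R F)).
  rewrite -(cvg_lim _ c) //; apply: limr_le; first by apply/cvg_ex; eexists; exact: c.
  apply: nearW => n; apply: le_trans (rad_pairing_decomposition r n xoo) _.
  by rewrite ler_pM2l.
(* This k satisfies 16 s < k < 2 ^ k. *)
have := bound (Num.truncn (16 * s)).+1; apply/negP; rewrite -ltNge.
rewrite ltr_pdivlMr // (_ : 2 * s * 8 = 16 * s); last by ring.
apply: (lt_trans (truncnS_gt _)); rewrite ltr_nat; exact: ltn_expl.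
Qed.

End Witness.

(** * Nonzero operators of arbitrarily small cost *)

Section NotDiscrete.
Context {R : realType} {F : scalar_kind}.
Local Notation H := (l2 R F).
Local Notation V := (opV R F).
Implicit Types t : R.

Definition corner t (i j : nat) : R := if (i == 0) && (j == 0) then t else 0.

Lemma corner_block t : block_diagonal (corner t).
Proof.
move=> i j; rewrite /corner; case: (i =P 0%N) => [->|//].
by case: (j =P 0%N) => [->|//]; rewrite eqxx.
Qed.

Lemma cornerC t i j : corner t i j = corner t j i.
Proof. by rewrite /corner andbC. Qed.

Lemma sum_corner t (G : nat -> nat -> R -> R) r : (forall i j, G i j 0 = 0) ->
  \sum_(i < 2 ^ r) \sum_(j < 2 ^ r) G i j (corner t i j) = G 0 0 t.
Proof.
move=> G0; have r0 : (0 < 2 ^ r)%N by rewrite expn_gt0.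
rewrite (bigD1 (Ordinal r0)) //= (bigD1 (Ordinal r0)) //= big1 => [|j].
  rewrite big1 ?addr0 // => i; rewrite -val_eqE /= => /negPf i0.
  by rewrite big1 // => j _; rewrite /corner i0.
by rewrite -val_eqE /= => /negPf j0; rewrite /corner j0.
Qed.

Lemma corner_norm t r : \sum_(i < 2 ^ r) \sum_(j < 2 ^ r) `|corner t i j| <= `|t|.
Proof. by rewrite (@sum_corner t (fun _ _ b => `|b|)) // => i j; rewrite normr0. Qed.

Definition corner_op t : V := mx_op (F := F) (@corner_block t) (@cornerC t) (@corner_norm t).

Lemma corner_op_neq0 t : t != 0 -> corner_op t != 0.
Proof.
move=> t0; apply/eqP => /(congr1 (fun A : V => A (delta 0) 0%N)).
rewrite -[LHS]/(mx_fun _ _ _ _) mx_fun_delta /corner /=.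
by rewrite -[RHS](@of_real0 R F) => /of_real_inj/eqP; rewrite (negPf t0).
Qed.

(** A single vector, the square root of t times [delta 0], padded with zeros, decomposes the
    operator at cost t. *)
Lemma U_plus_corner_op t e : 0 <= t -> t < e -> U_plus e (corner_op t).
Proof.
move=> t0 te; apply/U_plusP; split.
  apply: Gamma_mx_op => r u.
  rewrite (@sum_corner t (fun i j b => b * (u i * u j))) => [|i j]; last by rewrite mul0r.
  by rewrite mulr_ge0 // -expr2 sqr_ge0.
pose s := of_real F (Num.sqrt t).
pose x k : H := if k == 0%N then s *: delta 0 else 0.
have l1 : l1norm (delta 0 : H) = 1%E.
  rewrite /l1norm (@nneseriesD1 _ _ 0) => [|j _|//]; last by rewrite lee_fin sabs_ge0.
  rewrite eseries0 => [|j _ /andP[_ /negPf /= ->]]; last by rewrite sabs0.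
  by rewrite /= sabs1 adde0.
have l10 : l1norm (0 : H) = 0%E.
  by rewrite -(scale0r (0 : H)) l1normZ sabs0 mul0e.
have lx k : l1norm (x k) = (if k == 0%N then Num.sqrt t else 0)%:E.
  rewrite /x; case: eqP => // _.
  by rewrite l1normZ l1 mule1 sabs_of_real ger0_norm ?sqrtr_ge0.
exists x; first split=> [k|v].
- by rewrite lx ltry.
- apply: cvg_near_cst; near=> n.
  have n0 : (0 < n)%N by near: n; exact: nbhs_infty_gt.
  rewrite (_ : _ - _ = 0) ?l2norm0 //; apply/eqP; rewrite subr_eq0; apply/eqP.
  rewrite big_mkord (bigD1 (Ordinal n0)) //= big1 => [|k]; last first.
    by rewrite -val_eqE /= /x => /negPf ->; rewrite /rank_one scaler0.
  rewrite addr0 /x /= /rank_one; apply: l2_eq => i.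
  rewrite innerZr inner_deltar sconj_real.
  rewrite -[LHS]/(of_real F (Num.sqrt t) * v 0%N * (of_real F (Num.sqrt t) * (i == 0%N)%:R)).
  rewrite -[RHS]/(mx_apply (corner t) v i) /mx_apply /corner; case: (i =P 0%N) => [->|_] /=.
    rewrite /dyadic_block up_log1 expn0 big_ord1 /= mulr1 mulrAC -of_realM -expr2.
    by rewrite sqr_sqrtr.
  by rewrite !mulr0 big1 // => j _; rewrite of_real0 mul0r.
- rewrite /cost (@nneseriesD1 _ _ 0) => [|j _|//]; last by rewrite lx -EFin_expe lee_fin sqr_ge0.
  rewrite eseries0 => [|j _ /andP[_ /negPf j0]]; last by rewrite lx j0 -EFin_expe expr0n.
  by rewrite lx -EFin_expe adde0 lte_fin /= sqr_sqrtr.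
Unshelve. all: by end_near. Qed.

End NotDiscrete.

(** * The topology *)

Lemma uncountable_real (R : realType) : ~ countable [set: R].
Proof.
move=> cR; have : countable (`[0, 1] : set R) by apply: sub_countable cR; exact: subset_card_le.
move/countable_lebesgue_measure0; rewrite lebesgue_measure_itv /= lte_fin ltr01 oppr0 adde0.
by move/eqP; rewrite onee_eq0.
Qed.

Section Topology.
Context {R : realType} {F : scalar_kind}.
Local Notation V := (opV R F).
Implicit Types (A B T : V) (O : set V) (e r : R).

Lemma translateP T (S : set V) A : translate T S A <-> S (A - T).
Proof.
split=> [[B SB <-]|SA]; first by rewrite addrC addKr.
by exists (A - T) => //; rewrite addrC subrK.
Qed.

Lemma translate_U_refl A r : 0 < r -> translate A (U_plus r) A.
Proof. by move=> r0; apply/translateP; rewrite subrr; exact: U_plus0. Qed.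

Lemma U_plus_le e r A : e <= r -> U_plus e A -> U_plus r A.
Proof.
by move=> er [GA Ae]; split => //; apply: (lt_le_trans Ae); rewrite lee_fin.
Qed.

Lemma translate_U_nbhs T e A : translate T (U_plus e) A ->
  exists2 r, 0 < r & translate A (U_plus r) `<=` translate T (U_plus e).
Proof.
move=> /translateP /U_plus_nbhs[r r0 h]; exists r => // B /translateP/h BU.
by apply/translateP; rewrite (_ : B - T = A - T + (B - A)) // [RHS]addrC addrA subrK.
Qed.

Lemma open_translate_U T e : 0 < e -> open (translate T (U_plus e)).
Proof.
move=> e0; exists [set translate T (U_plus e)]; last by rewrite bigcup_set1.
move=> _ ->.
exact: (@finI_from1 _ _ [set p : V * R | 0 < p.2] (fun p => translate p.1 (U_plus p.2)) (T, e)).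
Qed.

(** Finite intersections of subbasic sets are handled by taking the minimum of the radii. *)
Lemma translate_U_nbhs_seq A (s : seq (V * R)) :
  (forall p, p \in s -> translate p.1 (U_plus p.2) A) ->
  exists2 r, 0 < r &
    forall p, p \in s -> translate A (U_plus r) `<=` translate p.1 (U_plus p.2).
Proof.
elim: s => [|p t ih] pt; first by exists 1.
have [r r0 rt] := ih (fun q qt => pt q (mem_behead (s := p :: t) qt)).
have [r' r'0 rp] := translate_U_nbhs (pt p (mem_head _ _)).
exists (Num.min r r'); first by rewrite lt_min r0.
move=> q; rewrite inE => /predU1P[->|qt] B /translateP BU.
  by apply/rp/translateP; apply: U_plus_le BU; rewrite ge_min lexx orbT.
by apply/(rt q qt)/translateP; apply: U_plus_le BU; rewrite ge_min lexx.
Qed.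

(** The working description of the topology: translates centred at the point itself suffice.
    Conversely, such an O is the union of the basic sets it contains. *)
Lemma open_opVP O :
  open O <-> forall A, O A -> exists2 r, 0 < r & translate A (U_plus r) `<=` O.
Proof.
split=> [[D sD <-] A [S DS SA]|h].
  have [s _ sS] : finI_from [set p : V * R | 0 < p.2]
    (fun p => translate p.1 (U_plus p.2)) S by exact: sD DS.
  have [|r r0 rs] := @translate_U_nbhs_seq A (finmap.enum_fset s).
    by move=> p ps; have : S A by []; rewrite -sS; apply.
  exists r => // B BU; exists S => //.
  have SB : S B by rewrite -sS => p ps; exact: rs BU.
  exact: SB.
rewrite (_ : O = \bigcup_(p in [set p : V * R | 0 < p.2 /\ translate p.1 (U_plus p.2) `<=` O])
  translate p.1 (U_plus p.2)).
  by apply: bigcup_open => p [p0 _]; exact: open_translate_U.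
apply/seteqP; split=> [A OA|A [p [_ pO] pA]]; last exact: pO.
by have [r r0 rO] := h A OA; exists (A, r) => //; exact: translate_U_refl.
Qed.

Lemma nbhs_opVP A (N : set V) :
  nbhs A N <-> exists2 r, 0 < r & translate A (U_plus r) `<=` N.
Proof.
rewrite nbhsE; split=> [[W [+ WA] WN]|[r r0 rN]].
  move=> /open_opVP oW; have [r r0 rW] := oW A WA; exists r => //; exact: subset_trans WN.
exists (translate A (U_plus r)) => //; split; first exact: open_translate_U.
exact: translate_U_refl.
Qed.

Lemma opV_hausdorff : hausdorff_space V.
Proof.
move=> A B AB; apply/eqP; rewrite -subr_eq0; apply/eqP/opV_entries_eq0 => i j.
apply/eqP; rewrite -sabs_eq0 eq_le sabs_ge0 andbT; apply/ler_addgt0Pr => e e0.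
rewrite add0r; have e20 : 0 < e / 2 by rewrite divr_gt0.
have nb (C : V) : nbhs C (translate C (U_plus (e / 2))) by apply/nbhs_opVP; exists (e / 2).
(* A common point C of the two neighbourhoods makes A - B a difference of two operators of cost
   below e / 2. *)
have [C [ /translateP /U_plusP[_ [x dx xe]] /translateP /U_plusP[_ [y dy ye]]]] :=
  AB _ _ (nb A) (nb B).
rewrite (_ : A - B = (C - B) - (C - A)); last by rewrite opprB [RHS]addrC addrA subrK.
rewrite [X in sabs X](_ : _ = (C - B) (delta i) j - (C - A) (delta i) j) //.
apply: le_trans (ler_sabsD _ _) _; rewrite sabsN [leRHS]splitr lerD //.
  exact: (decomposes_entry _ _ dy (ltW ye)).
exact: (decomposes_entry _ _ dx (ltW xe)).
Qed.

Lemma open_translate T O : open O <-> open (translate T O).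
Proof.
suff h S O' : open O' -> open (translate S O').
  split=> [|/(h (- T))]; first exact: h.
  rewrite (_ : translate (- T) (translate T O) = O) //.
  by apply/seteqP; split=> A; rewrite !translateP opprK addrK.
move=> /open_opVP oO; apply/open_opVP => A /translateP /oO[r r0 rO].
exists r => // B /translateP BA; apply/translateP/rO/translateP.
by rewrite opprB addrA subrK.
Qed.

Lemma opV_first_countable : first_countable V.
Proof.
move=> A; exists [set translate A (U_plus n.+1%:R^-1) | n in [set: nat]]; split.
- exact: card_image_le.
- move=> _ [n _ <-]; apply/nbhs_opVP; exists n.+1%:R^-1 => //; by rewrite invr_gt0.
- move=> N /nbhs_opVP[r r0 rN].
  exists (translate A (U_plus (Num.truncn r^-1).+1%:R^-1)); first by exists (Num.truncn r^-1).
  apply: subset_trans rN => B /translateP BA; apply/translateP; apply: U_plus_le BA.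
  rewrite -[leRHS]invrK lef_pV2 ?posrE ?invr_gt0 //.
  by rewrite ltW // truncnS_gt.
Qed.

Lemma basic_sets_basis : basis (@basic_sets R F).
Proof.
split=> [_ [T [e [e0 ->]]]|A]; first exact: open_translate_U.
move=> N /nbhs_opVP[r r0 rN]; exists (translate A (U_plus r)) => //; split.
  by exists A, r.
exact: translate_U_refl.
Qed.

Lemma open_bigcup_basic O : open O ->
  exists2 G : set (set V), G `<=` basic_sets & O = \bigcup_(S in G) S.
Proof.
move=> /open_opVP oO; exists [set S | basic_sets S /\ S `<=` O]; first by move=> S [].
apply/seteqP; split=> [A OA|A [S [_ SO] SA]]; last exact: SO.
have [r r0 rO] := oO A OA; exists (translate A (U_plus r)); last exact: translate_U_refl.
by split=> //; exists A, r.
Qed.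

Lemma line_U_plus (A0 : V) (s t : R) : Gamma A0 -> ~ Gamma_plus A0 ->
  Gamma_plus (s *: A0 - t *: A0) -> s = t.
Proof.
move=> GA0 nA0; rewrite -scalerBl => h.
have [st|ts|//] := ltgtP s t; exfalso; apply: nA0.
  (* For s < t the multiple and its opposite are both positive, which forces A0 = 0, an element of
     [Gamma_plus]. *)
  have : Gamma (- ((s - t) *: A0)).
    by rewrite -scaleNr opprB; apply: GammaZ => //; rewrite subr_ge0 ltW.
  move=> /(Gamma_plus_antisym h)/eqP; rewrite scaler_eq0 subr_eq0 lt_eqF //= => /eqP ->.
  exact: U_plus_Gamma_plus (U_plus0 (ltr01)).
have st0 : s - t != 0 by rewrite subr_eq0 gt_eqF.
rewrite -[A0]scale1r -(mulVf st0) -scalerA; apply: Gamma_plusZ => //.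
by rewrite invr_ge0 subr_ge0 ltW.
Qed.

(** The translate of [U_plus 1] by a point of the line meets the line in that point only, so a union
    of such translates traces out S. *)
Lemma line_discrete (A0 : V) : Gamma A0 -> ~ Gamma_plus A0 ->
  forall S : set (set_type (range (fun t : R => t *: A0))), open S.
Proof.
move=> GA0 nA0 S.
exists (\bigcup_(x in S) translate (set_val x) (U_plus 1)).
  by apply: bigcup_open => x _; exact: open_translate_U.
apply/seteqP; split=> [y [x Sx xy]|y Sy]; last first.
  by exists y => //; exact: translate_U_refl.
move: xy => /translateP /U_plus_Gamma_plus xy.
have [s _ sE] := set_valP y; have [t _ tE] := set_valP x.
have st : s = t by apply: (line_U_plus GA0 nA0); rewrite sE tE.
suff -> : y = x by [].
by apply: val_inj; rewrite -[LHS]sE -[RHS]tE st.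
Qed.

(** For each t a base element [f t] is chosen that contains t *: A0 and lies in its neighbourhood of
    radius 1. If f s = f t, then s *: A0 lies in the neighbourhood of t *: A0, so s = t. Thus the
    reals would inject into a countable base. *)
Lemma opV_not_second_countable (A0 : V) : Gamma A0 -> ~ Gamma_plus A0 ->
  ~ @second_countable V.
Proof.
move=> GA0 nA0 [B cB [_ Bb]]; apply: (@uncountable_real R).
have /choice[f fP] t : exists S, [/\ B S, S (t *: A0) &
    S `<=` translate (t *: A0) (U_plus 1)].
  have [S [BS St] SU] : filter_from [set U | B U /\ U (t *: A0)] id
      (translate (t *: A0) (U_plus 1)) by apply: Bb; apply/nbhs_opVP; exists 1.
  by exists S.
have /countable_injP[g ginj] := cB.
apply/countable_injP; exists (g \o f) => s t _ _ /=.
have [Bs ss _] := fP s; have [Bt _ tU] := fP t.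
move/(ginj _ _ (mem_set Bs) (mem_set Bt)) => fst.
move: ss; rewrite fst => /tU/translateP/U_plus_Gamma_plus.
exact: line_U_plus.
Qed.

End Topology.

Theorem proposition5p7 (R : realType) (F : scalar_kind) :
  [/\ hausdorff_space (opV R F),
      forall (T : opV R F) (O : set (opV R F)),
        open O <-> open (translate T O)
    & first_countable (opV R F)] /\
  (basis (@basic_sets R F) /\
   forall O : set (opV R F), open O ->
     exists2 G : set (set (opV R F)),
       G `<=` basic_sets & O = \bigcup_(S in G) S) /\
  ((forall (A : opV R F) (O : set (opV R F)), open O -> O A ->
      exists2 r : R, 0 < r & translate A (U_plus r) `<=` O) /\
   ~ (forall S : set (opV R F), open S)) /\
  ((exists A0 : opV R F, Gamma A0 /\ ~ Gamma_plus A0) /\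
   forall A0 : opV R F, Gamma A0 -> ~ Gamma_plus A0 ->
     forall S : set (set_type (range (fun t : R => t *: A0))), open S) /\
  ~ @second_countable (opV R F).
Proof.
pose A0 : opV R F := @witness_op R F.
have GA0 : Gamma A0 := Gamma_witness_op.
have nA0 : ~ Gamma_plus A0 := @witness_op_not_Gamma_plus R F.
split; first by split; [exact: opV_hausdorff|exact: open_translate|exact: opV_first_countable].
split; first by split; [exact: basic_sets_basis|exact: open_bigcup_basic].
split; first split.
- by move=> A O /open_opVP; exact.
(* If [[set 0]] were open it would contain some [U_plus r], and with it the nonzero
   [corner_op (r / 2)]. *)
- move=> /(_ [set 0]) /open_opVP /(_ 0 erefl)[r r0 rO].
  have r20 : 0 < r / 2 by rewrite divr_gt0.
  have /rO/eqP : translate 0 (U_plus r) (@corner_op R F (r / 2)).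
    apply/translateP; rewrite subr0; apply: U_plus_corner_op; first exact: ltW.
    by rewrite ltr_pdivrMr // mulr_natr mulr2n ltrDl.
  exact/negP/corner_op_neq0/lt0r_neq0.
split; first by split; [exists A0|exact: line_discrete].
exact: opV_not_second_countable GA0 nA0.
Qed.
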